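(* Let $n\geq 3$ be an integer. Then there is a polynomial $p\in\mathbb{Q}[X]$ of degree $n-1$ whose associated function $\mathbb{R}_{\geq 0}\to\mathbb{R}$, $x\mapsto p(x)$, is increasing and nonnegative and such that $$GP_n(F,d)\leq p(d)$$ for all rigid fields $F$ and all even integers $d\geq 2^n$.
   Context: All fields have characteristic different from $2$; quadratic form means finite-dimensional non-degenerate quadratic form. $IF$ is the fundamental ideal of the Witt ring $WF$ and $I^nF=(IF)^n$; a form and its Witt class are denoted by the same symbol. For $a_1,\dots,a_n\in F^\ast$, the $n$-fold Pfister form is $\langle\langle a_1,\ldots,a_n\rangle\rangle:=\langle 1,-a_1\rangle\otimes\cdots\otimes\langle 1,-a_n\rangle$, and $GP_nF$ denotes the set of forms similar to some $n$-fold Pfister form. For $\varphi\in I^nF$, the $n$-Pfister number $GP_n(\varphi)$ is the least $k\ge 0$ such that $\varphi=\pi_1+\cdots+\pi_k$ in $WF$ for some $\pi_1,\dots,\pi_k\in GP_nF$ (the zero class has Pfister number $0$). $GP_n(F,d):=\sup\{GP_n(\varphi)\mid \varphi \text{ a form over } F,\ \varphi\in I^nF,\ \dim\varphi\le d\}$. A field $F$ is rigid if every binary anisotropic quadratic form over $F$ represents at most $2$ square classes of $F^\ast/F^{\ast 2}$. *)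

(* Defs.v *)
From HB Require Import structures.
From mathcomp Require Import all_boot all_order all_algebra.
From mathcomp Require Import mxtens.
From mathcomp Require Import boolp classical_sets functions cardinality reals ereal.

Set Implicit Arguments.
Unset Strict Implicit.
Unset Printing Implicit Defensive.

Import Order.TTheory GRing.Theory Num.Theory.

Local Open Scope classical_set_scope.
Local Open Scope card_scope.
Local Open Scope ring_scope.

(* A non-degenerate quadratic form in qdim variables, given by its Gram matrix;
   as 2 is invertible in the intended fields, quadratic forms and symmetric
   bilinear forms are the same thing.  The zero-dimensional form is allowed. *)
Record qform (F : fieldType) := QForm {
  qdim : nat;
  gram : 'M[F]_qdim;
  gramP : (gram^T == gram) && (gram \in unitmx) }.

Section Forms.
Variable F : fieldType.
Implicit Types (phi psi rho : qform F) (a b c : F).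

Definition qval phi (v : 'rV[F]_(qdim phi)) : F :=
  (v *m gram phi *m v^T) 0 0.
Arguments qval : clear implicits.

Definition isometric phi psi : Prop :=
  exists f : {linear 'rV[F]_(qdim phi) -> 'rV[F]_(qdim psi)},
    bijective f /\ forall v, qval psi (f v) = qval phi v.

Definition similar phi psi : Prop :=
  exists2 c, c != 0 &
  exists f : {linear 'rV[F]_(qdim phi) -> 'rV[F]_(qdim psi)},
    bijective f /\ forall v, qval psi (f v) = c * qval phi v.

Definition anisotropic phi : Prop := forall v, qval phi v = 0 -> v = 0.

Definition represents phi a : Prop := a != 0 /\ exists v, qval phi v = a.

Fact qzero_subproof :
  ((0 : 'M[F]_0)^T == 0) && ((0 : 'M[F]_0) \in unitmx).
Proof. by rewrite trmx0 eqxx unitmxE det_mx00 unitr1. Qed.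
Definition qzero : qform F := QForm qzero_subproof.

Fact unary_subproof a (a0 : a != 0) :
  ((a%:M : 'M_1)^T == a%:M) && ((a%:M : 'M_1) \in unitmx).
Proof. by rewrite tr_scalar_mx eqxx unitmxE det_scalar1 unitfE. Qed.
Definition unary a (a0 : a != 0) : qform F := QForm (unary_subproof a0).

Fact qorth_subproof phi psi :
  let A := block_mx (gram phi) 0 0 (gram psi) in
  (A^T == A) && (A \in unitmx).
Proof.
case: phi psi => [m A /= /andP[/eqP As Au]] [n B /= /andP[/eqP Bs Bu]].
rewrite tr_block_mx !trmx0 As Bs eqxx unitmxE det_ublock.
by rewrite unitrM -!unitmxE Au Bu.
Qed.
Definition qorth phi psi : qform F := QForm (qorth_subproof phi psi).

Fact qtens_subproof phi psi :
  let A := gram phi *t gram psi in (A^T == A) && (A \in unitmx).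
Proof.
case: phi psi => [m A /= /andP[/eqP As Au]] [n B /= /andP[/eqP Bs Bu]].
rewrite trmx_tens As Bs eqxx /=.
have unit0 k (C : 'M[F]_k) : k = 0%N -> C \in unitmx.
  by case: k C => [|k] C // _; rewrite unitmxE det_mx00 unitr1.
have [m0|m0] := eqVneq m 0%N; first by apply: unit0; rewrite m0.
have [n0|n0] := eqVneq n 0%N; first by apply: unit0; rewrite n0 muln0.
exact: tensmx_unit.
Qed.
Definition qtens phi psi : qform F := QForm (qtens_subproof phi psi).

Definition qsum k (phi : 'I_k -> qform F) : qform F :=
  \big[qorth/qzero]_(i < k) phi i.

Fact oppr_neq0 a : a != 0 -> - a != 0.
Proof. by rewrite oppr_eq0. Qed.

(* The binary form <1, -a>. *)
Definition pfister1 a (a0 : a != 0) : qform F :=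
  qorth (unary (oner_neq0 F)) (unary (oppr_neq0 a0)).

Definition hyperbolic_plane : qform F := pfister1 (oner_neq0 F).

(* Equality of classes in the Witt ring WF. *)
Definition witt_eq phi psi : Prop :=
  exists m n : nat,
    isometric (qorth phi (qsum (fun _ : 'I_m => hyperbolic_plane)))
              (qorth psi (qsum (fun _ : 'I_n => hyperbolic_plane))).

(* The Witt class of phi lies in I^n F.  I^0 F = WF, and I^(n+1) F is the
   ideal product IF * I^n F, i.e. the set of finite sums of products; IF
   consists of the classes of the even-dimensional forms. *)
Fixpoint in_In (n : nat) phi : Prop :=
  if n is m.+1 then
    exists (k : nat) (rho psi : 'I_k -> qform F),
      (forall i, ~~ odd (qdim (rho i)) /\ in_In m (psi i)) /\
      witt_eq phi (qsum (fun i => qtens (rho i) (psi i)))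
  else True.

Definition pfister n (a : n.-tuple {x : F | x != 0}) : qform F :=
  foldr (fun x : {x : F | x != 0} => qtens (pfister1 (valP x)))
        (unary (oner_neq0 F)) a.

Definition GP n phi : Prop :=
  exists a : n.-tuple {x : F | x != 0}, similar phi (pfister a).

Definition sum_of_GP n k phi : Prop :=
  exists pi : 'I_k -> qform F,
    (forall i, GP n (pi i)) /\ witt_eq phi (qsum pi).

Definition square_class a : set F := [set a * t ^+ 2 | t in [set t | t != 0]].

Definition rigid : Prop :=
  forall phi, qdim phi = 2%N -> anisotropic phi ->
    [set square_class a | a in represents phi] #<= `I_2.

(* The least k such that phi is a sum of k elements of GP_n F in WF; a least
   element of a set of naturals, hence its infimum (+oo if there is none). *)
Definition pfister_number (R : realType) n phi : \bar R :=
  ereal_inf [set k%:R%:E | k in [set k | sum_of_GP n k phi]].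

Definition pfister_bound (R : realType) n d : \bar R :=
  ereal_sup [set pfister_number R n phi |
              phi in [set phi | in_In n phi /\ (qdim phi <= d)%N]].

End Forms.

Arguments rigid : clear implicits.
Arguments pfister_bound : clear implicits.

(* Main.v *)
Require Import Defs.
From HB Require Import structures.
From mathcomp Require Import all_boot all_order all_algebra.
From mathcomp Require Import generic_quotient mxtens ring zify.
From mathcomp Require Import boolp classical_sets cardinality reals ereal.

Set Implicit Arguments.
Unset Strict Implicit.
Unset Printing Implicit Defensive.

Import Order.TTheory GRing.Theory Num.Theory.
Local Open Scope ring_scope.

(** The bound is p(X) = (X + 1)^(n-1).

Write <a> for the Witt class of the unary form with entry a. Every class is a sum of such lines, and
an additive map out of the Witt group is a function on F that respects the relations
<ab^2> = <a>, <a> + <-a> = 0 and <a> + <b> = <a+b> + <ab(a+b)> (lemma witt_lift; it rests on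
Witt cancellation and on rewriting a diagonal form so that any value it takes becomes an entry).
Over a rigid field the third relation nearly collapses: up to squares a+b is a or b, unless
b = -a or 4<a> = 0 (rigid_binary, line_four). So a function on square classes that respects
the sign has an additive extension under very mild conditions (rigid_additive).

Let K be a subgroup of index 2 of the square classes that contains -1, and let e lie outside K. Then
there are two such maps. Specialisation sends k and ek to k, for k in K; the residue sends k to 0
and ek to k. Specialisation preserves I^n, the residue maps I^n to I^(n-1), and every class is
x = rho(x) - <<e>> del(x) (residue_decomposition). Hence
if x has at most d diagonal entries, in the group spanned by -1 and m + 1 elements, then rho(x) and
del(x) have at most d entries in the group spanned by -1 and m of them, and
B(n, m+1) <= B(n, m) + B(n-1, m), where B(n, m) is the number of n-fold Pfister forms that such
classes in I^n need.

The recursion stops in two cases. For n = 2 one has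
<a,b,c> = a<<-ab,-ac>> + <-abc>, so d forms suffice once classes in I^2 with at most two
entries vanish (pfister_sum_fundamental2). For m = 0 the class is an
integer multiple j<1>: either 4<1> = 0 and the n = 2 analysis shows that it vanishes, or there is an
integral signature, which forces 2^n to divide j, and x is j/2^n times <<-1,...,-1>>
(pfister_sum_unit_span). Therefore B(n, m) <= d(m+1)^(n-2). The entries themselves span the
group, so m <= d, and d(d+1)^(n-2) <= (d+1)^(n-1).

Subgroups of index 2 that contain a given subgroup and miss a given element come from
Zorn's lemma (subgroup_avoiding). *)

(** * Isometry of Gram matrices *)

Section Isometry.
Variable F : fieldType.
Implicit Types (phi psi chi : qform F) (a b c : F).

(** The matrix side of isometry. The inverse is part of the data because the two sizes are
    equal only propositionally. *)
Definition congruent phi psi : Prop :=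
  exists (P : 'M[F]_(qdim phi, qdim psi)) (Q : 'M[F]_(qdim psi, qdim phi)),
    [/\ P *m Q = 1%:M, Q *m P = 1%:M & P *m gram psi *m P^T = gram phi].

Lemma gram_sym phi : (gram phi)^T = gram phi.
Proof. by case: phi => m A /= /andP[/eqP]. Qed.

Lemma gram_unit phi : gram phi \in unitmx.
Proof. by case: phi => m A /= /andP[]. Qed.

Lemma congruent_refl phi : congruent phi phi.
Proof. by exists 1%:M, 1%:M; rewrite trmx1 !mulmx1 mul1mx. Qed.

Lemma congruent_sym phi psi : congruent phi psi -> congruent psi phi.
Proof.
move=> [P [Q [PQ QP E]]]; exists Q, P; split=> //.
by rewrite -E !mulmxA QP mul1mx -mulmxA -trmx_mul QP trmx1 mulmx1.
Qed.

Lemma congruent_trans psi phi chi :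
  congruent phi psi -> congruent psi chi -> congruent phi chi.
Proof.
move=> [P [Q [PQ QP E]]] [P' [Q' [PQ' QP' E']]]; exists (P *m P'), (Q' *m Q); split.
- by rewrite mulmxA -(mulmxA P) PQ' mulmx1.
- by rewrite mulmxA -(mulmxA Q') QP mulmx1.
- by rewrite trmx_mul !mulmxA -(mulmxA P) -(mulmxA P) E'.
Qed.

Lemma congruent_orth phi phi' psi psi' :
  congruent phi phi' -> congruent psi psi' ->
  congruent (qorth phi psi) (qorth phi' psi').
Proof.
move=> [P [Q [PQ QP E]]] [P' [Q' [PQ' QP' E']]].
exists (block_mx P 0 0 P'), (block_mx Q 0 0 Q'); split=> /=.
- by rewrite mulmx_block !(mul0mx, mulmx0, addr0, add0r) PQ PQ' -scalar_mx_block.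
- by rewrite mulmx_block !(mul0mx, mulmx0, addr0, add0r) QP QP' -scalar_mx_block.
- by rewrite tr_block_mx !trmx0 !mulmx_block !(mul0mx, mulmx0, addr0, add0r) E E'.
Qed.

Lemma congruent_orthC phi psi : congruent (qorth phi psi) (qorth psi phi).
Proof.
exists (block_mx 0 1%:M 1%:M 0), (block_mx 0 1%:M 1%:M 0); split=> /=.
- by rewrite mulmx_block !(mul0mx, mulmx0, addr0, add0r, mulmx1) -scalar_mx_block.
- by rewrite mulmx_block !(mul0mx, mulmx0, addr0, add0r, mulmx1) -scalar_mx_block.
- by rewrite tr_block_mx !trmx0 !trmx1 !mulmx_block !(mul0mx, mulmx0, addr0, add0r, mulmx1, mul1mx).
Qed.

(** Associativity of sums and distributivity of tensor products of matrices hold only up to a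
    cast of the size; this turns such casts into congruences. *)
Lemma congruent_cast m n (e : n = m) (A : 'M[F]_m) (B : 'M[F]_n)
    (hA : (A^T == A) && (A \in unitmx)) (hB : (B^T == B) && (B \in unitmx)) :
  castmx (e, e) B = A -> congruent (QForm hA) (QForm hB).
Proof.
case: m / e A hA => A hA /=; rewrite castmx_id => E; subst A.
by rewrite (bool_irrelevance hA hB); exact: congruent_refl.
Qed.

Lemma congruent_orthA phi psi chi :
  congruent (qorth phi (qorth psi chi)) (qorth (qorth phi psi) chi).
Proof.
apply: (congruent_cast (e := esym (addnA _ _ _))) => /=.
have := @block_mxA F _ _ _ _ _ _ (gram phi) 0 0 0 (gram psi) 0 0 0 (gram chi).
by rewrite !row_mx0 !col_mx0 => /= ->; congr castmx; congr pair; apply: eq_irrelevance.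
Qed.

Lemma congruent_orth0 phi : congruent (qorth (qzero F) phi) phi.
Proof.
exists (col_mx 0 1%:M), (row_mx 0 1%:M); split=> /=.
- rewrite mul_col_row !(mul0mx, mulmx0, mulmx1).
  apply: etrans (esym (@scalar_mx_block _ 0 (qdim phi) 1)).
  by congr block_mx; apply/matrixP=> -[].
- by rewrite mul_row_col mul0mx add0r mulmx1.
- rewrite mul_col_mx mul0mx mul1mx tr_col_mx trmx0 trmx1 mul_col_row.
  rewrite !(mul0mx, mulmx0, mulmx1); congr block_mx.
Qed.

Hypothesis two_neq0 : (2%:R : F) != 0.

(** Polarisation: in characteristic not 2 the values of a symmetric form determine it. *)
Lemma sym_form0 n (A : 'M[F]_n) :
  A^T = A -> (forall v : 'rV_n, (v *m A *m v^T) 0 0 = 0) -> A = 0.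
Proof.
move=> As A0; apply/matrixP=> i j; rewrite mxE.
have E k l : ((delta_mx 0 k : 'rV_n) *m A *m (delta_mx 0 l : 'rV_n)^T) 0 0 = A k l.
  by rewrite -rowE trmx_delta -colE !mxE.
have := A0 (delta_mx 0 i + delta_mx 0 j : 'rV_n).
have addE (u v : 'M[F]_1) : (u + v) 0 0 = u 0 0 + v 0 0 by rewrite mxE.
rewrite linearD /= mulmxDl mulmxDr !mulmxDl !addE !E.
have := A0 (delta_mx 0 i); have := A0 (delta_mx 0 j); rewrite !E => -> ->.
have <- : A i j = A j i by rewrite -[in RHS]As mxE.
rewrite add0r addr0.
by move/eqP; rewrite -mulr2n -mulr_natl mulf_eq0 (negPf two_neq0) => /eqP.
Qed.

Lemma isometricP phi psi : isometric phi psi <-> congruent phi psi.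
Proof.
split=> [[f [[g fK gK] fq]]|[P [Q [PQ QP E]]]].
  pose P := lin1_mx f; pose Q := \matrix_i g (row i 1%:M).
  have fP u : u *m P = f u by rewrite mul_rV_lin1.
  have QP : Q *m P = 1%:M.
    by apply/row_matrixP=> i; rewrite row_mul rowK fP gK.
  have PQ : P *m Q = 1%:M.
    apply/row_matrixP=> i; rewrite row_mul; apply: (can_inj fK).
    by rewrite -!fP -mulmxA QP mulmx1 row1 rowE.
  exists P, Q; split=> //; apply/eqP; rewrite -subr_eq0; apply/eqP.
  apply: sym_form0 => [|v].
    by rewrite linearB /= !trmx_mul trmxK !gram_sym mulmxA.
  have := fq v; rewrite /qval -fP trmx_mul mulmxBr mulmxBl !mulmxA => E.
  by rewrite [LHS]mxE [X in _ + X]mxE E subrr.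
exists (mulmxr P); split.
  by exists (mulmxr Q) => v /=; rewrite -mulmxA ?PQ ?QP mulmx1.
by move=> v; rewrite /qval /= -E trmx_mul !mulmxA.
Qed.
End Isometry.

(** * Witt cancellation and diagonalisation *)

Section Diagonalisation.
Variable F : fieldType.
Hypothesis two_neq0 : (2%:R : F) != 0.
Implicit Types (phi psi chi : qform F) (a b c : F).

Lemma congruent_square phi psi (D : 'M[F]_(qdim phi, qdim psi)) :
  qdim phi = qdim psi -> D *m gram psi *m D^T = gram phi -> congruent phi psi.
Proof.
case: phi D => m A hA /=; case: psi => n B hB /= D e; subst m => E.
have uA : A \in unitmx by case/andP: hA.
have R1 : D *m (B *m D^T *m invmx A) = 1%:M by rewrite !mulmxA E mulmxV.
by exists D, (B *m D^T *m invmx A); split=> //=; apply: mulmx1C.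
Qed.

Lemma congruent_qdim phi psi : congruent phi psi -> qdim phi = qdim psi.
Proof.
move=> [P [Q [/mulmx1_min PQ /mulmx1_min QP _]]].
by apply/eqP; rewrite eqn_leq PQ.
Qed.

(** The coefficient that Witt cancellation needs: the quadratic equation has the root 1/(1-p), and
    at p = 1, where it is linear, the root -1/2. *)
Lemma cancel_root (p : F) : exists l : F, l ^+ 2 * (1 - p ^+ 2) - 2 * l * p - 1 = 0.
Proof.
have [->|p1] := eqVneq p 1; first by exists (- (2%:R)^-1); field.
by exists (1 - p)^-1; field; rewrite subr_eq0 eq_sym.
Qed.

(** If the block matrix (p r; c D) carries <b> + psi to <b> + phi, then D + l cr carries psi to phi
    for a suitable scalar l: every error term is a multiple of the rank one matrix c c^T, and its
    coefficient is b times the left-hand side of the equation in cancel_root. This replaces the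
    usual argument with a reflection. *)
Lemma witt_cancellation b (b0 : b != 0) phi psi :
  congruent (qorth (unary b0) phi) (qorth (unary b0) psi) -> congruent phi psi.
Proof.
move=> h; have [e] : (1 + qdim phi = 1 + qdim psi)%N by exact: (congruent_qdim h).
case: h => [P [_ [_ _]]] /= {}.
move: P; rewrite /= => P; rewrite -[P]submxK.
set r := ursubmx P; set c := dlsubmx P; set D := drsubmx P.
rewrite (mx11_scalar (ulsubmx P)); set p := _ 0 0.
rewrite tr_block_mx !mulmx_block !(mulmx0, mul0mx, addr0, add0r).
rewrite tr_scalar_mx -!scalar_mxM.
case/eq_block_mx => E1 E2 E3 E4.
have [l El] := cancel_root p.
apply: (congruent_square (D := D + l *: (c *m r))) => //.
have {}E1 : r *m gram psi *m r^T = (b - p * b * p)%:M.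
  by rewrite raddfB /= -E1 addrC addKr.
have {}E2 : r *m gram psi *m D^T = - ((p * b) *: c^T).
  by apply/eqP; rewrite -addr_eq0 addrC -[X in X + _]mul_scalar_mx E2.
have {}E3 : D *m gram psi *m r^T = - ((p * b) *: c).
  apply/eqP; rewrite -addr_eq0 addrC; apply/eqP; rewrite -E3; congr (_ + _).
  by rewrite -mulmxA -scalar_mxM mul_mx_scalar mulrC.
have {}E4 : D *m gram psi *m D^T = gram phi - b *: (c *m c^T).
  by rewrite -E4 mul_mx_scalar -scalemxAl [X in _ = X - _]addrC addrK.
rewrite linearD /= linearZ /= trmx_mul !(mulmxDl, mulmxDr) -!(scalemxAl, scalemxAr).
rewrite !mulmxA.
have -> : c *m r *m gram psi *m D^T = c *m (r *m gram psi *m D^T).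
  by rewrite !mulmxA.
have -> : c *m r *m gram psi *m r^T *m c^T = c *m (r *m gram psi *m r^T) *m c^T.
  by rewrite !mulmxA.
rewrite E1 E2 E3 E4 mulmxN mulNmx mul_mx_scalar -!(scalemxAl, scalemxAr).
set X := c *m c^T; rewrite !scalerN !scalerA -addrA -!scaleNr -!scalerDl.
rewrite -addrA -scalerDl [Y in _ + Y *: _](_ : _ = 0) ?scale0r ?addr0 //.
by rewrite -[RHS](mulr0 b) -El; ring.
Qed.

Lemma symmetric_unit_anisotropic_vector n (A : 'M[F]_n.+1) :
  A^T = A -> A \in unitmx -> exists v : 'rV_n.+1, (v *m A *m v^T) 0 0 != 0.
Proof.
move=> As Au; apply: contrapT => /forallNP h.
have A0 : A = 0 by apply: (sym_form0 two_neq0) => // v; apply/eqP/negPn/negP.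
by move: Au; rewrite A0 unitmxE det0 unitr0.
Qed.

(** Complete v to a basis, so that its value b becomes the upper left entry of the Gram matrix,
    then clear the first row and column by the Schur complement. *)
Lemma split_unary n phi b (b0 : b != 0) (v : 'rV[F]_(qdim phi)) :
  qdim phi = n.+1 -> qval v = b ->
  exists2 psi, qdim psi = n & congruent phi (qorth (unary b0) psi).
Proof.
case: phi v => m A hA /= v e; subst m; rewrite /qval /= => Ev.
have /andP[/eqP As Au] := hA.
have v0 : v != 0 by apply: contraNneq b0 => v0; rewrite -Ev v0 !mul0mx mxE.
pose U := row_ebase v; have uU : U \in unitmx := row_ebase_unit v.
(* Gaussian elimination of the row v: its extended row basis starts with a multiple of v. *)
have [c vE] : exists c, v = c *: row 0 U.
  exists (col_ebase v 0 0); rewrite -{1}(mulmx_ebase v) {1}(mx11_scalar (col_ebase v)).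
  rewrite rank_rV v0 mul_scalar_mx -scalemxAl rowE; congr (_ *: _); congr (_ *m _).
  by apply/matrixP=> i j; rewrite !mxE !ord1 /= andbT eq_sym.
have c0 : c != 0.
  apply: (contraNneq _ v0) => c0. by rewrite vE c0 scale0r.
pose V : 'M_(1 + n) := block_mx c%:M 0 0 1%:M *m (U : 'M_(1 + n)).
have uV : V \in unitmx.
  by rewrite unitmx_mul uU andbT unitmxE det_lblock det_scalar1 det1 mulr1 unitfE.
have vV : usubmx V = v.
  rewrite vE -[U](@vsubmxK _ 1 n n.+1) /V /block_mx mul_col_mx col_mxKu.
  rewrite -[X in _ *m X](@vsubmxK _ 1 n n.+1) mul_row_col mul0mx addr0 mul_scalar_mx.
  congr (_ *: _); apply/rowP=> j; rewrite mxE [RHS]mxE.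
  by rewrite vsubmxK; congr (U _ _); apply/val_inj.
move: (V) uV vV => {V} V uV vV.
pose B : 'M_(1 + n) := V *m (A : 'M_(1 + n)) *m V^T.
have Bs : B^T = B.
  by rewrite /B !trmx_mul trmxK As mulmxA.
have uB : B \in unitmx by rewrite !unitmx_mul uV Au unitmx_tr uV.
have B11 : ulsubmx B = b%:M.
  rewrite [LHS]mx11_scalar -Ev; congr (_%:M).
  by rewrite -vV trmx_usub mulmx_lsub !mul_usub_mx.
have [r [D [Ds EB]]] : exists r D, D^T = D /\ B = block_mx b%:M r r^T D.
  exists (ursubmx B), (drsubmx B); split; first by rewrite trmx_drsub Bs.
  by rewrite -[LHS]submxK B11; congr block_mx; rewrite trmx_ursub Bs.
pose S : 'M_(1 + n) := block_mx 1%:M 0 (- (b^-1 *: r^T)) 1%:M.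
pose G := D - b^-1 *: (r^T *m r).
have SB : S *m B *m S^T = block_mx b%:M 0 0 G.
  rewrite EB /S tr_block_mx !trmx0 !trmx1 !mulmx_block.
  rewrite !(mulmx0, mul0mx, addr0, add0r, mulmx1, mul1mx) linearN linearZ /= trmxK.
  have E1 : - (b^-1 *: r^T) *m b%:M + r^T = 0.
    by rewrite mul_mx_scalar scalerN scalerA mulfV // scale1r addNr.
  rewrite E1 mul0mx add0r; congr block_mx.
    by rewrite mul_scalar_mx scalerN scalerA mulfV // scale1r addNr.
  by rewrite /G mulNmx -scalemxAl addrC.
have uS : S \in unitmx by rewrite unitmxE det_lblock !det1 mulr1 unitr1.
have uG : (G^T == G) && (G \in unitmx).
  rewrite /G linearB linearZ /= trmx_mul trmxK Ds eqxx /= -/G.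
  have : block_mx (b%:M : 'M_1) 0 0 G \in unitmx by rewrite -SB unitmx_mul unitmx_tr uS andbT unitmx_mul uS.
  by rewrite !unitmxE det_lblock unitrM => /andP[].
exists (QForm uG) => //; apply: congruent_sym.
apply: (@congruent_square (qorth (unary b0) (QForm uG)) (QForm hA) (S *m V)) => //=.
by rewrite -SB /B trmx_mul !mulmxA.
Qed.

(** Zero entries are skipped, so that every sequence gives a non-degenerate form; the convention
    <0> = 0 is kept for Witt classes and spares side conditions throughout. *)
Definition qdiag (s : seq F) : qform F :=
  foldr (fun a phi => if insub a is Some u
                      then qorth (@unary F (val (u : {x : F | x != 0})) (valP u)) phi
                      else phi)
        (qzero F) s.

Lemma qdiag_cons a (a0 : a != 0) s : qdiag (a :: s) = qorth (unary a0) (qdiag s).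
Proof. by rewrite /= (insubT (fun x => x != 0) a0) /=; congr (qorth (unary _) _); exact: bool_irrelevance. Qed.

Lemma qdiag0 s : qdiag (0 :: s) = qdiag s.
Proof. by rewrite /= insubF ?eqxx. Qed.

Lemma diagonalize phi : exists s, [/\ size s = qdim phi, 0 \notin s & congruent phi (qdiag s)].
Proof.
have [n] := ubnP (qdim phi); elim: n phi => // n IHn phi.
case E : (qdim phi) => [|m] ltmn.
  exists [::]; split=> //.
  by apply: (@congruent_square _ _ 0) => //; case: phi E => k A hA /= E; subst k; apply/matrixP => -[].
have [v qv] : exists v : 'rV_(qdim phi), qval v != 0.
  case: phi E => k A hA /= E; subst k; have /andP[/eqP As Au] := hA.
  exact: symmetric_unit_anisotropic_vector.
have [psi dpsi hpsi] := split_unary qv E erefl.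
have [|s [ss s0 hs]] := IHn psi; first by rewrite dpsi.
exists (qval v :: s); split; first by rewrite /= ss dpsi.
  by rewrite inE negb_or eq_sym qv.
rewrite (qdiag_cons qv).
exact: congruent_trans hpsi (congruent_orth (congruent_refl _) hs).
Qed.

End Diagonalisation.

(** * Additive invariants of diagonal forms *)

Section Invariants.
Variable F : fieldType.
Hypothesis two_neq0 : (2%:R : F) != 0.
Implicit Types (phi psi chi : qform F) (a b c : F) (s t : seq F).

(** These are the defining relations of the Witt group on the generators <a>. *)
Definition witt_additive (A : zmodType) (f : F -> A) : Prop :=
  [/\ f 0 = 0,
      forall a b, b != 0 -> f (a * b ^+ 2) = f a,
      forall a, f a + f (- a) = 0
    & forall a b, a + b != 0 -> f a + f b = f (a + b) + f (a * b * (a + b))].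

(** Isometry by elementary moves: besides the isometry it records that every function respecting
    the relations has the same sum over both sequences, which is what the moves are for. *)
Definition chain_equiv s t : Prop :=
  congruent (qdiag s) (qdiag t) /\
  forall (A : zmodType) (f : F -> A), witt_additive f ->
    \sum_(a <- s) f a = \sum_(a <- t) f a.

Lemma qval_orth phi psi x y :
  qval (row_mx x y : 'rV_(qdim (qorth phi psi))) = qval x + qval y.
Proof.
rewrite /qval /= mul_row_block !(mulmx0, addr0, add0r) tr_row_mx mul_row_col.
by rewrite mxE.
Qed.

Lemma qval_unary a (a0 : a != 0) (x : 'rV_(qdim (unary a0))) :
  qval x = a * x 0 0 ^+ 2.
Proof.
rewrite /qval /= [x]mx11_scalar tr_scalar_mx -!scalar_mxM !mxE eqxx !mulr1n.
by ring.
Qed.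

Lemma congruent_qval phi psi :
  congruent phi psi -> forall v, exists w : 'rV_(qdim psi), qval w = qval (v : 'rV_(qdim phi)).
Proof.
move=> [P [_ [_ _ E]]] v; exists (v *m P).
by rewrite /qval -E trmx_mul !mulmxA.
Qed.

Lemma chain_trans t s u : chain_equiv s t -> chain_equiv t u -> chain_equiv s u.
Proof.
move=> [st fst] [tu ftu]; split; first exact: congruent_trans st tu.
by move=> A f hf; rewrite fst // ftu.
Qed.

Lemma chain_cons a s t : chain_equiv s t -> chain_equiv (a :: s) (a :: t).
Proof.
move=> [st fst]; split; last by move=> A f hf; rewrite !big_cons fst.
have [->|a0] := eqVneq a 0; first by rewrite !qdiag0.
rewrite !(qdiag_cons a0); exact: congruent_orth (congruent_refl _) st.
Qed.

Lemma chain_zero s : chain_equiv (0 :: s) s.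
Proof.
split; first by rewrite qdiag0; exact: congruent_refl.
by move=> A f [f0 _ _ _]; rewrite big_cons f0 add0r.
Qed.

Lemma chain_square a x s : a != 0 -> x != 0 -> chain_equiv (a :: s) (a * x ^+ 2 :: s).
Proof.
move=> a0 x0; have ax0 : a * x ^+ 2 != 0 by rewrite mulf_neq0 ?expf_neq0.
split; last by move=> A f [_ fsq _ _]; rewrite !big_cons fsq.
rewrite (qdiag_cons a0) (qdiag_cons ax0); apply: congruent_orth (congruent_refl _).
apply: congruent_sym; apply: (@congruent_square _ (unary ax0) (unary a0) x%:M) => //=.
by rewrite tr_scalar_mx -!scalar_mxM; congr (_%:M); ring.
Qed.

Lemma congruent_orthCA phi psi chi :
  congruent (qorth phi (qorth psi chi)) (qorth psi (qorth phi chi)).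
Proof.
apply: congruent_trans (congruent_orthA _ _ _) _.
apply: congruent_trans (congruent_orth (congruent_orthC _ _) (congruent_refl _)) _.
exact: congruent_sym (congruent_orthA _ _ _).
Qed.

Lemma chain_swap a b s : a != 0 -> b != 0 -> chain_equiv (a :: b :: s) (b :: a :: s).
Proof.
move=> a0 b0; split; last by move=> A f _; rewrite !big_cons addrCA.
by rewrite !(qdiag_cons a0, qdiag_cons b0); exact: congruent_orthCA.
Qed.

(** In the plane with orthogonal basis u, v of lengths a, b, the vectors u + v and -bu + av are
    orthogonal of lengths a + b and ab(a+b). *)
Lemma congruent_binary a b (a0 : a != 0) (b0 : b != 0) (c0 : a + b != 0)
    (d0 : a * b * (a + b) != 0) :
  congruent (qorth (unary a0) (unary b0)) (qorth (unary c0) (unary d0)).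
Proof.
apply: congruent_sym.
apply: (@congruent_square _ (qorth (unary c0) (unary d0)) (qorth (unary a0) (unary b0))
  (block_mx 1%:M 1%:M (- b)%:M a%:M)) => //=.
rewrite tr_block_mx !tr_scalar_mx !mulmx_block !(mulmx0, mul0mx, addr0, add0r).
rewrite -!scalar_mxM -!raddfD /=; congr block_mx; try by congr (_%:M); ring.
  by rewrite -[RHS](raddf0 (@scalar_mx F 1)); congr (_%:M); ring.
by rewrite -[RHS](raddf0 (@scalar_mx F 1)); congr (_%:M); ring.
Qed.

Lemma chain_binary a b s : a != 0 -> b != 0 -> a + b != 0 ->
  chain_equiv (a :: b :: s) (a + b :: a * b * (a + b) :: s).
Proof.
move=> a0 b0 c0; have d0 : a * b * (a + b) != 0 by rewrite !mulf_neq0.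
split; last by move=> A f [_ _ _ fb]; rewrite !big_cons !addrA fb.
rewrite !(qdiag_cons a0, qdiag_cons b0, qdiag_cons c0, qdiag_cons d0).
apply: congruent_trans (congruent_orthA _ _ _) _.
apply: congruent_trans (congruent_sym (congruent_orthA _ _ _)).
exact: congruent_orth (congruent_binary _ _ _ _) (congruent_refl _).
Qed.

(** A value of <a> + u is ax^2 + c with c a value of u. By induction c may be taken as the first
    entry of u, and then the binary move puts ax^2 + c in front. *)
Lemma chain_represents s (v : 'rV_(qdim (qdiag s))) : qval v != 0 ->
  exists s', chain_equiv s (qval v :: s').
Proof.
elim: s v => [|a s IHs] v; first by rewrite /qval [v]thinmx0 !mul0mx mxE eqxx.
have [a0|a0] := eqVneq a 0.
  move: v; rewrite a0 qdiag0 => v /IHs[s' hs']; exists s'.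
  exact: chain_trans (chain_zero _) hs'.
move: v; rewrite (qdiag_cons a0) => v; rewrite -[v](@hsubmxK _ 1 1) qval_orth qval_unary.
set x := (lsubmx v) 0 0; set y := rsubmx v => b0.
have [qy0|qy0] := eqVneq (qval y) 0.
  rewrite qy0 addr0 in b0 *; exists s; apply: chain_square => //.
  by apply: contraNneq b0 => ->; rewrite expr0n mulr0.
have [s' hs'] := IHs y qy0.
have [x0|x0] := eqVneq x 0.
  exists (a :: s'); rewrite x0 expr0n mulr0 add0r.
  by apply: chain_trans (chain_cons a hs') _; exact: chain_swap.
have ax0 : a * x ^+ 2 != 0 by rewrite mulf_neq0 ?expf_neq0.
eexists; apply: chain_trans (chain_cons a hs') _.
apply: chain_trans (chain_square _ a0 x0) _.
exact: chain_binary.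
Qed.

(** Induction on t: its first entry b is represented by s, so s can be rewritten to start with b,
    and Witt cancellation removes b from both sides. *)
Lemma congruent_sum (A : zmodType) (f : F -> A) s t : witt_additive f ->
  congruent (qdiag s) (qdiag t) -> \sum_(a <- s) f a = \sum_(a <- t) f a.
Proof.
move=> hf; have [f0 _ _ _] := hf.
elim: t s => [|b t IHt] s hst.
  have := congruent_qdim hst; rewrite big_nil /=.
  elim: s {hst} => [|a s IHs]; first by rewrite big_nil.
  have [->|a0] := eqVneq a 0; first by rewrite qdiag0 big_cons f0 add0r.
  by rewrite (qdiag_cons a0).
have [b0|b0] := eqVneq b 0.
  by rewrite b0 big_cons f0 add0r; apply: IHt; move: hst; rewrite b0 qdiag0.
have [v qv] : exists v : 'rV_(qdim (qdiag s)), qval v = b.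
  move: hst; rewrite (qdiag_cons b0) => /congruent_sym/congruent_qval.
  move=> /(_ (row_mx (1%:M : 'M_1) 0))[v qv]; exists v; rewrite qv.
  by rewrite qval_orth qval_unary /qval !mul0mx !mxE eqxx expr1n mulr1 addr0.
have [|s' [hs' fs']] := @chain_represents s v; first by rewrite qv.
rewrite fs' // !big_cons qv; congr (_ + _); apply: IHt.
apply: (@witt_cancellation _ two_neq0 b b0).
by rewrite -!(qdiag_cons b0) -qv; apply: congruent_trans (congruent_sym hs') _; rewrite qv.
Qed.

End Invariants.

(** * The Witt group and maps out of it *)

HB.instance Definition _ (F : fieldType) := gen_eqMixin (qform F).
HB.instance Definition _ (F : fieldType) := gen_choiceMixin (qform F).

Section WittGroup.
Local Open Scope quotient_scope.
Variable F : fieldType.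
Hypothesis two_neq0 : (2%:R : F) != 0.
Implicit Types (phi psi chi : qform F) (a b c : F) (s t : seq F).

Definition hyperbolic m : qform F := qsum (fun _ : 'I_m => hyperbolic_plane F).

Lemma qsum0 (pi : 'I_0 -> qform F) : qsum pi = qzero F.
Proof. by rewrite /qsum big_ord0. Qed.

Lemma qsumS k (pi : 'I_k.+1 -> qform F) :
  qsum pi = qorth (pi ord0) (qsum (fun i => pi (lift ord0 i))).
Proof. by rewrite /qsum big_ord_recl. Qed.

Lemma hyperbolicS m : hyperbolic m.+1 = qorth (hyperbolic_plane F) (hyperbolic m).
Proof. by rewrite /hyperbolic qsumS. Qed.

Lemma hyperbolicD m n :
  congruent (hyperbolic (m + n)) (qorth (hyperbolic m) (hyperbolic n)).
Proof.
elim: m => [|m IHm].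
  by rewrite add0n /(hyperbolic 0) qsum0; apply: congruent_sym; exact: congruent_orth0.
rewrite addSn !hyperbolicS.
apply: congruent_trans (congruent_orth (congruent_refl _) IHm) _.
exact: congruent_orthA.
Qed.

Lemma congruent_orthAC phi psi chi :
  congruent (qorth (qorth phi psi) chi) (qorth (qorth phi chi) psi).
Proof.
apply: congruent_trans (congruent_sym (congruent_orthA _ _ _)) _.
apply: congruent_trans (congruent_orth (congruent_refl _) (congruent_orthC _ _)) _.
exact: congruent_orthA.
Qed.

Lemma witt_eqP phi psi : witt_eq phi psi <->
  exists m n, congruent (qorth phi (hyperbolic m)) (qorth psi (hyperbolic n)).
Proof. by split=> -[m [n h]]; exists m, n; apply/(isometricP two_neq0). Qed.

Lemma congruent_witt_eq phi psi : congruent phi psi -> witt_eq phi psi.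
Proof.
by move=> h; apply/witt_eqP; exists 0%N, 0%N; exact: congruent_orth h (congruent_refl _).
Qed.

Lemma witt_eq_sym phi psi : witt_eq phi psi -> witt_eq psi phi.
Proof.
by move=> /witt_eqP[m [n h]]; apply/witt_eqP; exists n, m; exact: congruent_sym.
Qed.

Lemma witt_eq_trans psi phi chi : witt_eq phi psi -> witt_eq psi chi -> witt_eq phi chi.
Proof.
move=> /witt_eqP[m [n h]] /witt_eqP[p [q k]]; apply/witt_eqP.
exists (m + p)%N, (q + n)%N.
apply: congruent_trans (congruent_orth (congruent_refl _) (hyperbolicD _ _)) _.
apply: congruent_trans (congruent_orthA _ _ _) _.
apply: congruent_trans (congruent_orth h (congruent_refl _)) _.
apply: congruent_trans (congruent_orthAC _ _ _) _.
apply: congruent_trans (congruent_orth k (congruent_refl _)) _.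
apply: congruent_trans (congruent_sym (congruent_orthA _ _ _)) _.
apply: congruent_orth (congruent_refl _) _.
exact: congruent_sym (hyperbolicD _ _).
Qed.

Lemma witt_eq_orth phi phi' psi psi' :
  witt_eq phi phi' -> witt_eq psi psi' -> witt_eq (qorth phi psi) (qorth phi' psi').
Proof.
have half phi1 phi2 psi1 : witt_eq phi1 phi2 -> witt_eq (qorth phi1 psi1) (qorth phi2 psi1).
  move=> /witt_eqP[m [n h]]; apply/witt_eqP; exists m, n.
  apply: congruent_trans (congruent_orthAC _ _ _) _.
  apply: congruent_trans (congruent_orth h (congruent_refl _)) _.
  exact: congruent_orthAC.
move=> h k; apply: witt_eq_trans (half _ _ _ h) _.
apply: witt_eq_trans (congruent_witt_eq (congruent_orthC _ _)) _.
apply: witt_eq_trans (half _ _ _ k) _.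
exact: congruent_witt_eq (congruent_orthC _ _).
Qed.

Definition witt_rel : rel (qform F) := fun phi psi => `[< witt_eq phi psi >].

Lemma witt_rel_refl : reflexive witt_rel.
Proof. by move=> phi; apply/asboolP; exact: congruent_witt_eq (congruent_refl _). Qed.

Lemma witt_rel_sym : symmetric witt_rel.
Proof. by move=> phi psi; apply/idP/idP => /asboolP h; apply/asboolP; exact: witt_eq_sym. Qed.

Lemma witt_rel_trans : transitive witt_rel.
Proof.
by move=> psi phi chi /asboolP h /asboolP k; apply/asboolP; exact: witt_eq_trans h k.
Qed.

Definition witt_equiv := EquivRel witt_rel witt_rel_refl witt_rel_sym witt_rel_trans.
Definition witt := {eq_quot witt_equiv}.
HB.instance Definition _ := Choice.on witt.

Definition class phi : witt := \pi_({eq_quot witt_equiv}) phi.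

Lemma classP phi psi : class phi = class psi <-> witt_eq phi psi.
Proof.
by split=> [/eqmodP/asboolP //|h]; apply/eqmodP/asboolP.
Qed.

Definition representative (x : witt) : qform F := repr (x : {eq_quot witt_equiv}).

Lemma class_representative x : class (representative x) = x.
Proof. exact: reprK. Qed.

Lemma witt_eq_representative phi : witt_eq (representative (class phi)) phi.
Proof. by apply/classP; rewrite class_representative. Qed.

Lemma congruent_class phi psi : congruent phi psi -> class phi = class psi.
Proof. by move=> h; apply/classP/congruent_witt_eq. Qed.

Definition witt_zero : witt := class (qzero F).
Definition witt_add (x y : witt) : witt := class (qorth (representative x) (representative y)).

Lemma class_orth_add phi psi : class (qorth phi psi) = witt_add (class phi) (class psi).
Proof.
by apply/classP/witt_eq_sym; apply: witt_eq_orth; exact: witt_eq_representative.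
Qed.

Lemma witt_addA : associative witt_add.
Proof.
move=> x y z; rewrite -(class_representative x) -(class_representative y) -(class_representative z).
by rewrite -!class_orth_add; apply: congruent_class; exact: congruent_orthA.
Qed.

Lemma witt_addC : commutative witt_add.
Proof. by move=> x y; apply: congruent_class; exact: congruent_orthC. Qed.

Lemma witt_add0 : left_id witt_zero witt_add.
Proof.
move=> x; rewrite -{1}(class_representative x) -class_orth_add -{2}(class_representative x).
apply: congruent_class; exact: congruent_orth0.
Qed.

(** With p = (a+1)/2 and r = (a-1)/2, the rows (p, r) and (r, p) are orthogonal in <1,-1>,
    of lengths p^2 - r^2 = a and -a. *)
Lemma congruent_hyperbolic a (a0 : a != 0) (na0 : - a != 0) :
  congruent (qorth (unary a0) (unary na0)) (hyperbolic_plane F).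
Proof.
pose p := (a + 1) / 2%:R; pose r := (a - 1) / 2%:R.
apply: (@congruent_square _ (qorth (unary a0) (unary na0)) (hyperbolic_plane F)
  (block_mx p%:M r%:M r%:M p%:M)) => //=.
rewrite tr_block_mx !tr_scalar_mx !mulmx_block !(mulmx0, mul0mx, addr0, add0r).
rewrite -!scalar_mxM -!raddfD /=.
by congr block_mx; rewrite -1?[RHS](raddf0 (@scalar_mx F 1)); congr (_%:M); rewrite /p /r; field.
Qed.

Lemma class_hyperbolic_plane : class (hyperbolic_plane F) = witt_zero.
Proof.
apply/classP/witt_eqP; exists 0%N, 1%N; rewrite /hyperbolic qsum0 qsumS qsum0.
exact: congruent_trans (congruent_sym (congruent_orth0 _)) (congruent_refl _).
Qed.

(** Negation is obtained from existence: a diagonal form is inverted entry by entry. *)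
Lemma witt_opp_exists x : exists y, witt_add y x = witt_zero.
Proof.
rewrite -(class_representative x); set phi := representative x.
have [s [_ _ /congruent_class ->]] := diagonalize two_neq0 phi.
elim: s => [|a s [y IH]]; first by exists witt_zero; rewrite witt_add0.
have [->|a0] := eqVneq a 0; first by exists y; rewrite qdiag0.
have na0 : - a != 0 by rewrite oppr_eq0.
exists (witt_add (class (unary na0)) y).
rewrite (qdiag_cons a0) class_orth_add witt_addA -(witt_addA _ y) (witt_addC y) -!witt_addA IH.
rewrite (witt_addC (class (unary a0))) witt_add0 -class_orth_add -class_hyperbolic_plane.
apply: congruent_class; apply: congruent_trans (congruent_orthC _ _) _.
exact: congruent_hyperbolic.
Qed.

Definition witt_opp x : witt := projT1 (cid (witt_opp_exists x)).

Lemma witt_addN : left_inverse witt_zero witt_opp witt_add.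
Proof. by move=> x; rewrite /witt_opp; case: cid. Qed.

HB.instance Definition _ := GRing.isZmodule.Build witt witt_addA witt_addC witt_add0 witt_addN.

Lemma class_orth phi psi : class (qorth phi psi) = class phi + class psi.
Proof. exact: class_orth_add. Qed.

Lemma class_zero : class (qzero F) = 0.
Proof. by []. Qed.

Lemma class_qsum k (pi : 'I_k -> qform F) : class (qsum pi) = \sum_(i < k) class (pi i).
Proof.
elim: k pi => [|k IHk] pi; first by rewrite qsum0 big_ord0.
by rewrite qsumS class_orth IHk big_ord_recl.
Qed.

(** The class of <a>; it is total in a, and 0 for a = 0. *)
Definition line a : witt := class (qdiag [:: a]).

Lemma class_qdiag s : class (qdiag s) = \sum_(a <- s) line a.
Proof.
elim: s => [|a s IHs]; first by rewrite big_nil.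
rewrite big_cons -IHs /line; have [->|a0] := eqVneq a 0; first by rewrite !qdiag0 class_zero add0r.
by rewrite !(qdiag_cons a0) !class_orth class_zero addr0.
Qed.

Lemma chain_line s t : chain_equiv s t -> \sum_(a <- s) line a = \sum_(a <- t) line a.
Proof. by case=> /congruent_class h _; rewrite -!class_qdiag. Qed.

Lemma line0 : line 0 = 0.
Proof. by rewrite /line qdiag0. Qed.

Lemma class_unary a (a0 : a != 0) : class (unary a0) = line a.
Proof. by rewrite /line (qdiag_cons a0) class_orth class_zero addr0. Qed.

Lemma line_additive : witt_additive line.
Proof.
split; first exact: line0.
- move=> a b b0; have [->|a0] := eqVneq a 0; first by rewrite mul0r.
  by have := chain_line (chain_square [::] a0 b0); rewrite !big_seq1.
- move=> a; have [->|a0] := eqVneq a 0; first by rewrite oppr0 line0 addr0.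
  have na0 : - a != 0 by rewrite oppr_eq0.
  rewrite -(class_unary a0) -(class_unary na0) -class_orth.
  by rewrite (congruent_class (congruent_hyperbolic _ _)) class_hyperbolic_plane.
- move=> a b c0; have [->|a0] := eqVneq a 0; first by rewrite !mul0r line0 !add0r addr0.
  have [->|b0] := eqVneq b 0; first by rewrite mulr0 mul0r line0 !addr0.
  by have := chain_line (chain_binary [::] a0 b0 c0); rewrite !big_cons !big_nil !addr0.
Qed.

Lemma witt_diagonal x : exists s, 0 \notin s /\ x = \sum_(a <- s) line a.
Proof.
have [s [_ s0 h]] := diagonalize two_neq0 (representative x).
by exists s; split=> //; rewrite -class_qdiag -(congruent_class h) class_representative.
Qed.

(** The presentation of the Witt group by generators and relations: sum f over any
    diagonalisation. By congruent_sum the result does not depend on the choice, and the relation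
    f(1) + f(-1) = 0 makes hyperbolic planes invisible. *)
Lemma witt_lift (A : zmodType) (f : F -> A) : witt_additive f ->
  exists g : {additive witt -> A}, forall a, g (line a) = f a.
Proof.
move=> hf; have [_ _ fN _] := hf.
have [ext extE] : exists ext : qform F -> A,
    forall phi s, congruent phi (qdiag s) -> ext phi = \sum_(a <- s) f a.
  exists (fun phi => \sum_(a <- projT1 (cid (diagonalize two_neq0 phi))) f a) => phi s hs.
  case: cid => t [_ _ ht] /=; apply: (congruent_sum two_neq0) => //.
  exact: congruent_trans (congruent_sym ht) hs.
have extC phi psi : congruent phi psi -> ext phi = ext psi.
  have [s [_ _ hs]] := diagonalize two_neq0 psi => h.
  by rewrite (extE _ _ hs) (extE phi s) //; exact: congruent_trans h hs.
have extD phi psi : ext (qorth phi psi) = ext phi + ext psi.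
  have [s [_ _ hs]] := diagonalize two_neq0 phi.
  have [t [_ _ ht]] := diagonalize two_neq0 psi.
  rewrite (extE _ _ hs) (extE _ _ ht) -big_cat; apply: extE.
  apply: congruent_trans (congruent_orth hs ht) _.
  elim: s {hs} => [|a s IHs]; first exact: congruent_orth0.
  have [->|a0] := eqVneq a 0; first by rewrite cat_cons !qdiag0.
  rewrite cat_cons !(qdiag_cons a0).
  apply: congruent_trans (congruent_sym (congruent_orthA _ _ _)) _.
  exact: congruent_orth (congruent_refl _) IHs.
have extH m : ext (hyperbolic m) = 0.
  elim: m => [|m IHm].
    by rewrite /hyperbolic qsum0 (extE _ [::]) ?big_nil //; exact: congruent_refl.
  rewrite hyperbolicS extD IHm addr0.
  rewrite (extE _ [:: 1; -1]) ?big_cons ?big_nil ?addr0 ?fN //.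
  rewrite (qdiag_cons (oner_neq0 F)) (qdiag_cons (oppr_neq0 (oner_neq0 F))).
  apply: congruent_orth; first exact: congruent_refl.
  apply: congruent_trans (congruent_sym (congruent_orth0 _)) _; exact: congruent_orthC.
have extW phi psi : witt_eq phi psi -> ext phi = ext psi.
  by move=> /witt_eqP[m [n /extC]]; rewrite !extD !extH !addr0.
pose g (x : witt) := ext (representative x).
have gE phi : g (class phi) = ext phi by apply: extW; exact: witt_eq_representative.
have gB : zmod_morphism g.
  have gD x y : g (x + y) = g x + g y.
    by rewrite -{1}(class_representative x) -{1}(class_representative y) -class_orth gE extD.
  by move=> x y; apply/eqP; rewrite eq_sym subr_eq -gD subrK.
pose gM := GRing.isZmodMorphism.Build _ _ g gB.
pose G : {additive witt -> A} := HB.pack g gM.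
exists G => a; rewrite /= gE (extE _ [:: a]) ?big_seq1 //; exact: congruent_refl.
Qed.

Lemma scale_exists c : exists g : {additive witt -> witt}, forall a, g (line a) = line (c * a).
Proof.
apply: witt_lift; have [l0 lsq lN lD] := line_additive.
have [->|c0] := eqVneq c 0.
  by split=> * /=; rewrite !mul0r ?l0 ?addr0.
split=> [|a b b0|a|a b ab0] /=.
- by rewrite mulr0.
- by rewrite mulrA lsq.
- by rewrite mulrN lN.
have cab0 : c * a + c * b != 0 by rewrite -mulrDr mulf_neq0.
rewrite lD // -mulrDr; congr (_ + _); rewrite -[RHS](lsq _ c) //; congr line; ring.
Qed.

(** Multiplication by <c>. This action of the scalars is all of the ring structure that the
    argument uses. *)
Definition scale c : {additive witt -> witt} := projT1 (cid (scale_exists c)).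

Lemma scale_line c a : scale c (line a) = line (c * a).
Proof. by rewrite /scale; case: cid. Qed.

End WittGroup.

(** * Powers of the fundamental ideal and sums of Pfister forms *)

Section FundamentalIdeal.
Variable F : fieldType.
Hypothesis two_neq0 : (2%:R : F) != 0.
Implicit Types (phi psi chi : qform F) (a b c : F) (s t : seq F).
Local Notation W := (witt two_neq0).
Local Notation line := (line two_neq0).
Local Notation scale := (scale two_neq0).
Local Notation class := (class two_neq0).
Implicit Types x y : W.

Lemma witt_ind (P : W -> Prop) :
  P 0 -> (forall x y, P x -> P y -> P (x + y)) -> (forall a, P (line a)) ->
  forall x, P x.
Proof.
by move=> P0 PD Pl x; have [s [_ ->]] := witt_diagonal x; apply: big_ind.
Qed.

Lemma line_square a b : b != 0 -> line (a * b ^+ 2) = line a.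
Proof. by case: (line_additive two_neq0) => _ + _ _; exact. Qed.

Lemma lineN a : line (- a) = - line a.
Proof.
by case: (line_additive two_neq0) => _ _ /(_ a) lN _; apply/eqP; rewrite -addr_eq0 addrC lN.
Qed.

Lemma line_binary a b :
  a + b != 0 -> line a + line b = line (a + b) + line (a * b * (a + b)).
Proof. by case: (line_additive two_neq0) => _ _ _; exact. Qed.

Lemma scaleM a b x : scale a (scale b x) = scale (a * b) x.
Proof.
elim/witt_ind: x => [|x y IHx IHy|c]; first by rewrite !raddf0.
  by rewrite !raddfD /= IHx IHy.
by rewrite !scale_line mulrA.
Qed.

Lemma scale1 x : scale 1 x = x.
Proof.
elim/witt_ind: x => [|x y IHx IHy|c]; first by rewrite !raddf0.
  by rewrite raddfD /= IHx IHy.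
by rewrite scale_line mul1r.
Qed.

Lemma scaleN a x : scale (- a) x = - scale a x.
Proof.
elim/witt_ind: x => [|x y IHx IHy|c]; first by rewrite !raddf0.
  by rewrite !raddfD /= IHx IHy.
by rewrite !scale_line mulNr lineN.
Qed.

Lemma scale0 x : scale 0 x = 0.
Proof.
elim/witt_ind: x => [|x y IHx IHy|c]; first by rewrite !raddf0.
  by rewrite raddfD /= IHx IHy addr0.
by rewrite scale_line mul0r line0.
Qed.

Fact qscale_subproof c (c0 : c != 0) phi :
  ((c *: gram phi)^T == c *: gram phi) && (c *: gram phi \in unitmx).
Proof.
rewrite linearZ /= gram_sym eqxx /= unitmxE detZ unitrM unitfE expf_neq0 //=.
by rewrite -unitmxE gram_unit.
Qed.
Definition qscale c (c0 : c != 0) phi : qform F := QForm (qscale_subproof c0 phi).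

Lemma congruent_qscale c (c0 : c != 0) phi psi :
  congruent phi psi -> congruent (qscale c0 phi) (qscale c0 psi).
Proof.
move=> [P [Q [PQ QP E]]]; exists P, Q; split=> //=.
by rewrite -scalemxAr -scalemxAl E.
Qed.

Lemma class_qscale c (c0 : c != 0) phi : class (qscale c0 phi) = scale c (class phi).
Proof.
have [s [_ _ hs]] := diagonalize two_neq0 phi.
rewrite (congruent_class two_neq0 hs).
rewrite (congruent_class two_neq0 (congruent_qscale c0 hs)) => {hs phi}.
elim: s => [|a s IHs].
  rewrite /= class_zero raddf0 -(class_zero two_neq0); apply: congruent_class.
  by apply: (@congruent_square _ _ _ 0) => //; apply/matrixP => -[].
have [->|a0] := eqVneq a 0; first by rewrite qdiag0.
have ca0 : c * a != 0 by rewrite mulf_neq0.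
rewrite (qdiag_cons a0) class_orth raddfD /= -IHs class_unary scale_line -(class_unary two_neq0 ca0).
rewrite -class_orth; apply: congruent_class.
apply: (@congruent_square _ (qscale c0 (qorth (unary a0) (qdiag s)))
  (qorth (unary ca0) (qscale c0 (qdiag s))) 1%:M) => //=.
by rewrite trmx1 mul1mx mulmx1 scale_block_mx !scaler0 scale_scalar_mx.
Qed.

Lemma similar_qscale c (c0 : c != 0) phi : Defs.similar (qscale c0 phi) phi.
Proof.
exists c^-1; first by rewrite invr_eq0.
exists (@mulmxr F _ _ _ 1%:M); split; first by exists (@mulmxr F _ _ _ 1%:M) => v /=; rewrite !mulmx1.
move=> v; rewrite /qval /= mulmx1 -scalemxAr -scalemxAl [in RHS]mxE mulrA mulVf ?mul1r //.
Qed.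

Lemma tensmx1 m n : (1%:M : 'M[F]_m) *t (1%:M : 'M[F]_n) = 1%:M.
Proof.
apply/matrixP=> i j; case: (mxtens_indexP i) => i0 i1; case: (mxtens_indexP j) => j0 j1.
rewrite tensmxE !mxE (can_eq (@mxtens_indexK _ _)) xpair_eqE.
by rewrite -natrM mulnb.
Qed.

Lemma congruent_tens phi phi' psi :
  congruent phi phi' -> congruent (qtens phi psi) (qtens phi' psi).
Proof.
move=> [P [Q [PQ QP E]]]; exists (P *t 1%:M), (Q *t 1%:M); split=> /=.
- by rewrite tensmx_mul PQ mul1mx tensmx1.
- by rewrite tensmx_mul QP mul1mx tensmx1.
- by rewrite trmx_tens !tensmx_mul E trmx1 mul1mx mulmx1.
Qed.

Lemma tens_zero_left psi : class (qtens (qzero F) psi) = 0.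
Proof.
rewrite -(class_zero two_neq0); apply: congruent_class.
by apply: (@congruent_square _ _ _ 0) => //; apply/matrixP => -[].
Qed.

Lemma castmx_block_corner m m' k N (e1 : m = m') (e2 : (m' + k)%N = N) (e3 : N = (m + k)%N)
    (A : 'M[F]_m) (D : 'M[F]_k) :
  castmx (e3, e3) (castmx (e2, e2) (block_mx (castmx (e1, e1) A) 0 0 D)) = block_mx A 0 0 D.
Proof. by subst m' N; rewrite (eq_irrelevance e3 erefl) !castmx_id. Qed.

(** Tensoring with <a> is scaling by a, and the tensor product distributes over a first
    orthogonal summand, up to a cast of the matrix sizes. *)
Lemma class_tens_qdiag s psi : class (qtens (qdiag s) psi) = \sum_(a <- s) scale a (class psi).
Proof.
elim: s => [|a s IHs]; first by rewrite big_nil tens_zero_left.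
rewrite big_cons -IHs; have [->|a0] := eqVneq a 0; first by rewrite qdiag0 scale0 add0r.
rewrite (qdiag_cons a0) -(class_qscale a0) -class_orth; apply: congruent_class.
apply: congruent_sym.
apply: (congruent_cast
  (e := etrans (mulnDl 1 _ _) (congr1 (addn^~ _) (mul1n (qdim psi))))) => /=.
rewrite tens_block_mx !tens0mx tens_scalar_mx.
exact: castmx_block_corner.
Qed.

(** I^(n+1) as the additive group generated by <<a>> x for x in I^n. Since IF is additively generated
    by the scaled binary forms c<<a>>, this contains the ideal product IF I^n; see
    in_In_fundamental. *)
Inductive fundamental_power : nat -> W -> Prop :=
| Fundamental0 x : fundamental_power 0 x
| FundamentalZero n : fundamental_power n.+1 0
| FundamentalAdd n a x y : a != 0 -> fundamental_power n x ->
    fundamental_power n.+1 y -> fundamental_power n.+1 (x - scale a x + y).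
Local Notation Ipow := fundamental_power.

Lemma fundamental_zero n : Ipow n 0.
Proof. by case: n => [|n]; constructor. Qed.

Lemma fundamental_add n x y : Ipow n x -> Ipow n y -> Ipow n (x + y).
Proof.
case: n => [|n]; first by move=> _ _; constructor.
move En : n.+1 => m h; elim: h n En y => {m x} [//|n|m a x y a0 Ix _ _ IHy] k Ek z Iz.
  by rewrite add0r.
by rewrite -addrA; constructor => //; exact: (IHy k).
Qed.

Lemma fundamental_scale n c x : c != 0 -> Ipow n x -> Ipow n (scale c x).
Proof.
move=> c0; elim=> {n x} [x|n|n a x y a0 _ IHx _ IHy]; rewrite ?raddf0; [constructor|constructor|].
rewrite raddfD raddfB /= scaleM mulrC -scaleM.
exact: FundamentalAdd.
Qed.

Lemma fundamental_opp n x : Ipow n x -> Ipow n (- x).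
Proof.
by move=> Ix; rewrite -[x]scale1 -scaleN; apply: fundamental_scale => //; rewrite oppr_eq0 oner_neq0.
Qed.

Lemma fundamental_sub n x y : Ipow n x -> Ipow n y -> Ipow n (x - y).
Proof. by move=> Ix Iy; apply: fundamental_add => //; exact: fundamental_opp. Qed.

Lemma fundamental_pfister1 n a x : a != 0 -> Ipow n x -> Ipow n.+1 (x - scale a x).
Proof.
by move=> a0 Ix; rewrite -[X in Ipow _ X]addr0; constructor=> //; exact: fundamental_zero.
Qed.

Lemma fundamental_weaken n x : Ipow n.+1 x -> Ipow n x.
Proof.
move En : n.+1 => m h; elim: h n En => {m x} [//|m|m a x y a0 Ix _ _ IHy] n [En].
  exact: fundamental_zero.
subst n; apply: fundamental_add (IHy _ erefl).
by apply: fundamental_sub => //; exact: fundamental_scale.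
Qed.

(** An even-dimensional form is a sum of binary forms, and <a,b> = a<<-b/a>>. *)
Lemma fundamental_even n s x : ~~ odd (size s) -> 0 \notin s -> Ipow n x ->
  Ipow n.+1 (\sum_(a <- s) scale a x).
Proof.
move=> es s0 Ix; have [k] := ubnP (size s); elim: k s es s0 => // k IHk [|a [|b s]] //= es s0 sk.
  by rewrite big_nil; exact: fundamental_zero.
move: s0; rewrite !inE !negb_or ![0 == _]eq_sym => /and3P[a0 b0 s0].
rewrite !big_cons addrA; apply: fundamental_add; last first.
  by apply: IHk => //; [rewrite negbK in es | exact: ltn_trans (ltnSn _) _].
have -> : scale a x + scale b x = scale a x - scale (- (b / a)) (scale a x).
  by rewrite scaleN opprK scaleM divfK.
apply: fundamental_pfister1; first by rewrite oppr_eq0 mulf_neq0 ?invr_eq0.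
exact: fundamental_scale.
Qed.

Lemma in_In_fundamental n phi : in_In n phi -> Ipow n (class phi).
Proof.
elim: n phi => [|n IHn] phi /=; first by constructor.
move=> [k [rho [psi [h /(classP two_neq0) ->]]]]; rewrite class_qsum.
elim/big_ind: _ => [|x y|i _]; [exact: fundamental_zero|exact: fundamental_add|].
have [er /IHn Ipsi] := h i.
have [s [ss s0 hs]] := diagonalize two_neq0 (rho i).
rewrite (congruent_class two_neq0 (congruent_tens _ hs)) class_tens_qdiag.
by apply: fundamental_even; rewrite ?ss.
Qed.

Definition pfister_class (s : seq F) : W := foldr (fun a x => x - scale a x) (line 1) s.

Lemma class_pfister n (a : n.-tuple {x : F | x != 0}) :
  class (pfister a) = pfister_class (map val a).
Proof.
rewrite /pfister; elim: (tval a) => [|u s IHs] /=; first exact: class_unary.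
rewrite -IHs; set psi := foldr _ _ _.
have -> : pfister1 (valP u) = qorth (unary (oner_neq0 F)) (unary (oppr_neq0 (valP u))) by [].
have -> : class (qtens (qorth (unary (oner_neq0 F)) (unary (oppr_neq0 (valP u)))) psi) =
    class (qtens (qdiag [:: 1; - val u]) psi).
  apply: congruent_class; apply: congruent_tens.
  rewrite (qdiag_cons (oner_neq0 F)) (qdiag_cons (oppr_neq0 (valP u))).
  apply: congruent_orth; first exact: congruent_refl.
  apply: congruent_trans (congruent_sym (congruent_orth0 _)) _; exact: congruent_orthC.
by rewrite class_tens_qdiag !big_cons big_nil addr0 scale1 scaleN.
Qed.

Lemma GP_pfister_class n c s : c != 0 -> size s = n -> 0 \notin s ->
  exists2 pi, GP n pi & class pi = scale c (pfister_class s).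
Proof.
move=> c0 ss s0.
have [t ts] : exists t : seq {x : F | x != 0}, map val t = s.
  elim: s s0 {ss} => [|a s IHs]; first by exists [::].
  rewrite inE negb_or eq_sym => /andP[a0 /IHs[t <-]].
  by exists (exist _ a a0 :: t).
have st : size t == n by rewrite -ss -ts size_map.
exists (qscale c0 (pfister (Tuple st))); last by rewrite class_qscale class_pfister /= ts.
by exists (Tuple st); exact: similar_qscale.
Qed.

Inductive pfister_sum n : nat -> W -> Prop :=
| PfisterSum0 : pfister_sum n 0 0
| PfisterSumS k c s x : c != 0 -> size s = n -> 0 \notin s -> pfister_sum n k x ->
    pfister_sum n k.+1 (scale c (pfister_class s) + x).

Lemma pfister_sum_add n j k x y :
  pfister_sum n j x -> pfister_sum n k y -> pfister_sum n (j + k) (x + y).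
Proof.
move=> h hy; elim: h => [|{}j c s {}x c0 ss s0 _ IH]; first by rewrite add0r.
by rewrite addSn -addrA; constructor.
Qed.

Lemma pfister_sum_scale n k c x : c != 0 -> pfister_sum n k x -> pfister_sum n k (scale c x).
Proof.
move=> c0; elim=> [|j b s y b0 ss s0 _ IH]; first by rewrite raddf0; constructor.
by rewrite raddfD /= scaleM; constructor => //; rewrite mulf_neq0.
Qed.

Lemma pfister_sum_opp n k x : pfister_sum n k x -> pfister_sum n k (- x).
Proof.
move=> h; rewrite -[x]scale1 -scaleN.
by apply: pfister_sum_scale => //; rewrite oppr_eq0 oner_neq0.
Qed.

(** <<a>> times a scaled n-fold Pfister form is a scaled (n+1)-fold one, so multiplication by <<a>>
    keeps the number of summands. *)
Lemma pfister_sum_pfister1 n k a x : a != 0 -> pfister_sum n k x ->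
  pfister_sum n.+1 k (x - scale a x).
Proof.
move=> a0; elim=> [|j c s y c0 ss s0 _ IH]; first by rewrite raddf0 subr0; constructor.
rewrite raddfD /= opprD addrACA scaleM mulrC -scaleM -raddfB.
apply: (@PfisterSumS n.+1 j c (a :: s)) => //=; first by rewrite ss.
by rewrite inE negb_or eq_sym a0.
Qed.

Lemma sum_of_GP_pfister_sum n k phi : pfister_sum n k (class phi) -> sum_of_GP n k phi.
Proof.
move=> h; suff [pi [hpi E]] : exists pi : 'I_k -> qform F,
    (forall i, GP n (pi i)) /\ class phi = \sum_(i < k) class (pi i).
  by exists pi; split=> //; apply/(classP two_neq0); rewrite class_qsum.
elim: h => [|j c s x c0 ss s0 _ [pi [hpi ->]]].
  by exists (fun=> qzero F); split=> [[]|] //; rewrite big_ord0.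
have [rho hrho <-] := GP_pfister_class c0 ss s0.
exists (fun i => if unlift ord0 i is Some i' then pi i' else rho); split.
  by move=> i; case: unliftP.
rewrite big_ord_recl unlift_none; congr (_ + _).
by apply: eq_bigr => i _; rewrite liftK.
Qed.

End FundamentalIdeal.

(** * Square classes of a rigid field and subgroups of index two *)

Section SquareClasses.
Local Open Scope classical_set_scope.
Local Open Scope card_scope.
Variable F : fieldType.
Implicit Types (a b c : F).

Definition square_equiv a b : Prop := exists2 t, t != 0 & a = b * t ^+ 2.

Lemma square_equiv_sym a b : square_equiv a b -> square_equiv b a.
Proof.
move=> [t t0 ->]; exists t^-1; first by rewrite invr_eq0.
by rewrite -mulrA -exprMn mulfV // expr1n mulr1.
Qed.

Lemma square_class_eq a b : square_class a = square_class b -> square_equiv a b.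
Proof.
move=> E; have : square_class a a by exists 1; rewrite /= ?oner_neq0 // expr1n mulr1.
by rewrite E => -[t /= t0 <-]; exists t.
Qed.

Lemma anisotropic_binary a b (a0 : a != 0) (b0 : b != 0) :
  ~ square_equiv b (- a) -> anisotropic (qorth (unary a0) (unary b0)).
Proof.
move=> nab v; rewrite -[v](@hsubmxK _ 1 1 1) qval_orth !qval_unary.
set x := (lsubmx v : 'rV_1) 0 0; set y := (rsubmx v : 'rV_1) 0 0 => q0.
have y0 : y = 0.
  apply: contrapT => /eqP y0; apply: nab.
  have E : b * y ^+ 2 = - a * x ^+ 2 by apply/eqP; rewrite -subr_eq0 mulNr opprK addrC q0.
  have x0 : x != 0.
    apply: contraNneq (mulf_neq0 b0 (expf_neq0 2 y0)) => x0.
    by rewrite E x0 expr0n mulr0.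
  exists (x / y); first by rewrite mulf_neq0 ?invr_eq0.
  by rewrite expr_div_n mulrA -E mulfK ?expf_neq0.
have x0 : x = 0.
  move: q0; rewrite y0 expr0n mulr0 addr0 => /eqP.
  by rewrite mulf_eq0 (negPf a0) sqrf_eq0 => /eqP.
rewrite [lsubmx v]mx11_scalar [rsubmx v]mx11_scalar -/x -/y x0 y0 raddf0.
exact: row_mx0.
Qed.

Hypothesis rigidF : rigid F.

(** An anisotropic <a,b> represents a, b and a + b, but at most two square classes. *)
Lemma rigid_two_of_three a b : a != 0 -> b != 0 -> a + b != 0 ->
  [\/ square_equiv (a + b) a, square_equiv (a + b) b, square_equiv a b
    | square_equiv b (- a)].
Proof.
move=> a0 b0 c0; have [h4|n4] := pselect (square_equiv b (- a)); first exact: Or44.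
have an := @anisotropic_binary a b a0 b0 n4.
apply: contrapT => h.
have n1 : ~ square_equiv (a + b) a by move=> h1; apply: h; exact: Or41.
have n2 : ~ square_equiv (a + b) b by move=> h2; apply: h; exact: Or42.
have n3 : ~ square_equiv a b by move=> h3; apply: h; exact: Or43.
have := @rigidF (qorth (unary a0) (unary b0)) erefl an; set S := [set _ | _ in _] => S2.
(* Three pairwise distinct square classes would embed a three-element set into a set with at
   most two elements. *)
pose g i := square_class (nth 0 [:: a; b; a + b] i).
have gS : g @` `I_3 `<=` S.
  move=> _ [i /= i3 <-]; rewrite /g; exists (nth 0 [:: a; b; a + b] i) => //.
  split; first by case: i i3 => [|[|[|]]].
  have rep x y : exists v : 'rV_(qdim (qorth (unary a0) (unary b0))),
      qval v = a * x ^+ 2 + b * y ^+ 2.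
    by exists (row_mx x%:M y%:M); rewrite qval_orth !qval_unary !mxE eqxx !mulr1n.
  case: i i3 => [|[|[|]]] //= _.
  - by have [v E] := rep 1 0; exists v; rewrite E expr1n expr0n mulr1 mulr0 addr0.
  - by have [v E] := rep 0 1; exists v; rewrite E expr1n expr0n mulr1 mulr0 add0r.
  - by have [v E] := rep 1 1; exists v; rewrite E expr1n !mulr1.
have ginj : {in `I_3 &, injective g}.
  move=> i j; rewrite !inE /= /g => i3 j3 /square_class_eq.
  by case: i i3 => [|[|[|]]] //; case: j j3 => [|[|[|]]] //= _ _ e; exfalso;
    first [exact: (n1 e) | exact: (n2 e) | exact: (n3 e)
          | move/square_equiv_sym: e => e; first [exact: (n1 e) | exact: (n2 e) | exact: (n3 e)]].
have := card_le_trans (subset_card_le gS) S2.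
by rewrite (card_le_eql (inj_card_eq ginj)) card_le_II.
Qed.

(** Only the case a = bt^2 needs more than rigid_two_of_three. There a + b = b(1+t^2), and
    rigid_two_of_three for the binary form <1+t^2, -t^2>, whose entries add up to 1, shows that
    1 + t^2 is a square or minus a square, or that -1 is a square. *)
Lemma rigid_binary a b : a != 0 -> b != 0 -> a + b != 0 ->
  [\/ square_equiv (a + b) a, square_equiv (a + b) b, square_equiv b (- a)
    | square_equiv a b /\ square_equiv (a + b) (- a)].
Proof.
move=> a0 b0 ab0; have [||[t t0 at2]|] := rigid_two_of_three a0 b0 ab0; [exact: Or41|exact: Or42| |exact: Or43].
have [c0 E] : 1 + t ^+ 2 != 0 /\ a + b = b * (1 + t ^+ 2).
  have E : a + b = b * (1 + t ^+ 2) by rewrite at2; ring.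
  by split=> //; apply: contraNneq ab0 => c0; rewrite E c0 mulr0.
have nt0 : - t ^+ 2 != 0 by rewrite oppr_eq0 expf_neq0.
have := @rigid_two_of_three _ _ c0 nt0; rewrite addrK => /(_ (oner_neq0 F)).
case=> [/square_equiv_sym|[u u0 E1]|[u u0 E1]|[u u0 E1]].
- rewrite E => -[u u0 ->]; apply: Or42; exists u => //; ring.
- apply: Or43; exists u => //; rewrite at2 -[LHS]mulr1 [in LHS]E1; ring.
- by apply: Or44; split; [exists t | exists u => //; rewrite E E1 at2; ring].
- apply: Or42; apply: square_equiv_sym; exists (u / t); first by rewrite mulf_neq0 ?invr_eq0.
  rewrite E; move/(congr1 -%R): E1; rewrite opprK mulNr opprK expr_div_n => E1.
  by rewrite mulrA -(mulrA b) -E1 mulfK ?expf_neq0.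
Qed.

End SquareClasses.

Section Subgroups.
Variable F : fieldType.
Implicit Types (a b c x y : F) (H K : F -> Prop).

Definition square_subgroup K : Prop :=
  [/\ forall x, K x -> x != 0, forall t, t != 0 -> K (t ^+ 2)
    & forall x y, K x -> K y -> K (x * y)].

Lemma subgroup_cancel K x y : square_subgroup K -> K x -> K (x * y) -> K y.
Proof.
move=> [K0 Ksq KM] Kx Kxy; have x0 := K0 _ Kx.
have -> : y = x * (x * y) * x^-1 ^+ 2 by field.
by apply: (KM _ _ (KM _ _ Kx Kxy)); apply: Ksq; rewrite invr_eq0.
Qed.

Lemma subgroup_square K x t : square_subgroup K -> t != 0 -> K (x * t ^+ 2) <-> K x.
Proof.
move=> sK t0; have [_ Ksq KM] := sK; split; last by move=> Kx; apply: KM => //; exact: Ksq.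
by rewrite mulrC; apply: subgroup_cancel => //; exact: Ksq.
Qed.

Local Open Scope classical_set_scope.

(** A subgroup K that is maximal among those containing H and missing c has index 2: if neither x nor
    cx were in K, then K together with xK would be a larger subgroup that misses c. *)
Lemma subgroup_avoiding H c : square_subgroup H -> c != 0 -> ~ H c ->
  exists K, [/\ square_subgroup K, forall x, H x -> K x, ~ K c
    & forall x, x != 0 -> ~ K x -> K (c * x)].
Proof.
move=> sH c0 Hc; have [H0 Hsq HM] := sH.
(* P adjoins H, so that it also holds for the union of the empty chain. *)
pose P (X : set F) := square_subgroup (X `|` H) /\ ~ (X `|` H) c.
have [G GP totG|X [[sX Xc] maxX]] := @Zorn_bigcup F P.
  have sub x (X : set F) : G X -> (X `|` H) x -> (\bigcup_(X in G) X `|` H) x.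
    by move=> GX [Xx|Hx]; [left; exists X | right].
  split; last by case=> // -[X GX Xc]; case: (GP X GX) => _; apply; left.
  split=> [x|t t0|x y]; last 1 first.
  - case=> [[X GX Xx]|Hx]; case=> [[Y GY Yy]|Hy].
    + have [XY|YX] := totG X Y GX GY.
        apply: (sub _ Y) => //; have [[_ _ M] _] := GP Y GY.
        by apply: M; left => //; exact: XY.
      apply: (sub _ X) => //; have [[_ _ M] _] := GP X GX.
      by apply: M; left => //; exact: YX.
    + apply: (sub _ X) => //; have [[_ _ M] _] := GP X GX.
      by apply: M; [left|right].
    + apply: (sub _ Y) => //; have [[_ _ M] _] := GP Y GY.
      by apply: M; [right|left].
    + by right; exact: HM.
  - by case=> [[X GX Xx]|/H0 //]; have [[N _ _] _] := GP X GX; apply: N; left.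
  - by right; exact: Hsq.
exists (X `|` H); split=> // [x Hx|x x0 Kx]; first by right.
have [K0 Ksq KM] := sX; apply: contrapT => Kcx.
(* Y is the union of K and xK, as x^2 lies in K. *)
pose Y : set F := [set y | (X `|` H) y \/ (X `|` H) (x * y)].
apply: (maxX Y).
  split; first by move=> y Xy; left; left.
  move=> /(_ x) YX; apply: Kx; left; apply: YX; right.
  by rewrite -expr2; exact: Ksq.
have YH : Y `|` H = Y by apply/seteqP; split=> [y [//|Hy]|y Yy]; left=> //; right.
rewrite /P YH; split; last first.
  by case=> // Kxc; apply: Kcx; rewrite mulrC.
split=> [y|t t0|y z].
- by case=> /K0 //; rewrite mulf_eq0 negb_or => /andP[].
- by left; exact: Ksq.
- case=> Ky [] Kz.
  + by left; exact: KM.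
  + by right; rewrite mulrCA; exact: KM.
  + by right; rewrite mulrA; exact: KM.
  + left; apply: (subgroup_cancel sX (Ksq _ x0)).
    have -> : x ^+ 2 * (y * z) = (x * y) * (x * z) by ring.
    exact: KM.
Qed.

End Subgroups.

(** * Specialisation and residue along a subgroup of index two *)

Section RigidMaps.
Variable F : fieldType.
Hypothesis two_neq0 : (2%:R : F) != 0.
Hypothesis rigidF : rigid F.
Implicit Types (a b c t u : F) (K : F -> Prop).
Local Notation W := (witt two_neq0).
Local Notation line := (line two_neq0).
Local Notation scale := (scale two_neq0).
Local Notation Ipow := (@fundamental_power F two_neq0).

(** By rigid_binary the binary relation says nothing new, except when a = b and a + b = -a up to
    squares. There it reads 2f(a) = 2f(-a), which is 4f(a) = 0, and -1 is then a sum of two squares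
    of the shape required by the last hypothesis. *)
Lemma rigid_additive (A : zmodType) (f : F -> A) :
  f 0 = 0 ->
  (forall a b, b != 0 -> f (a * b ^+ 2) = f a) ->
  (forall a, f a + f (- a) = 0) ->
  (forall a t u, t != 0 -> u != 0 -> 1 + t ^+ 2 = - u ^+ 2 -> f a *+ 4 = 0) ->
  witt_additive f.
Proof.
move=> f0 fsq fN f4; split=> // a b ab0.
have [->|a0] := eqVneq a 0; first by rewrite !mul0r f0 !add0r addr0.
have [->|b0] := eqVneq b 0; first by rewrite mulr0 mul0r f0 !addr0.
case: (rigid_binary rigidF a0 b0 ab0) => [[t t0 E]|[t t0 E]|[t t0 E]|[[t t0 E1] [u u0 E2]]].
- rewrite E fsq // (_ : a * b * _ = b * (a * t) ^+ 2); last by ring.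
  by rewrite fsq ?mulf_neq0.
- rewrite E fsq // (_ : a * b * _ = a * (b * t) ^+ 2); last by ring.
  by rewrite fsq ?mulf_neq0 // addrC.
- rewrite (_ : a * b * (a + b) = - (a + b) * (a * t) ^+ 2); last by rewrite {1}E; ring.
  by rewrite fsq ?mulf_neq0 // fN E fsq.
- have -> : f b = f a by rewrite E1 fsq.
  have -> : f (a + b) = f (- a) by rewrite E2 fsq.
  have -> : f (a * b * (a + b)) = f (- a).
    rewrite (_ : a * b * (a + b) = - a * (b * (t * u)) ^+ 2); last by rewrite E2 {1}E1; ring.
    by rewrite fsq ?mulf_neq0.
  have fNE : f (- a) = - f a by apply/eqP; rewrite -addr_eq0 addrC fN.
  rewrite fNE; apply/eqP; rewrite -subr_eq0 opprD opprK; apply/eqP.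
  rewrite -(f4 a t (t * u)) ?mulrS ?mulr0n ?addr0 -?addrA ?mulf_neq0 //.
  apply: (mulfI b0); rewrite mulrDr mulr1 addrC -E1 E2 E1; ring.
Qed.

(** The binary relation for a and at^2, whose sum is -au^2, says 2<a> = -2<a>. *)
Lemma line_four a t u : t != 0 -> u != 0 -> 1 + t ^+ 2 = - u ^+ 2 -> line a *+ 4 = 0.
Proof.
move=> t0 u0 E; have [->|a0] := eqVneq a 0; first by rewrite line0 mul0rn.
have S : a + a * t ^+ 2 = - a * u ^+ 2 by rewrite mulNr -mulrN -E; ring.
have S0 : a + a * t ^+ 2 != 0 by rewrite S mulf_neq0 ?oppr_eq0 ?expf_neq0.
have atu0 : a * t * u != 0 by rewrite !mulf_neq0.
have := line_binary two_neq0 S0; rewrite S.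
rewrite (_ : a * _ * _ = - a * (a * t * u) ^+ 2); last by ring.
rewrite (line_square _ _ t0) (line_square _ _ u0) (line_square _ _ atu0) lineN => /eqP.
by rewrite -subr_eq0 opprD opprK addrA => /eqP h; rewrite !mulrS mulr0n addr0 !addrA.
Qed.

Section Retraction.
Variables (K : F -> Prop) (e : F).
Hypothesis sK : square_subgroup K.
Hypothesis KN1 : K (-1).
Hypothesis e0 : e != 0.
Hypothesis Kindex : forall x, x != 0 -> ~ K x -> K (e * x).

Definition retract x : F := if `[< K x >] then x else e * x.

Lemma retract_in x : K x -> retract x = x.
Proof. by move=> Kx; rewrite /retract; case: asboolP. Qed.

Lemma retract_out x : ~ K x -> retract x = e * x.
Proof. by move=> Kx; rewrite /retract; case: asboolP. Qed.

Lemma retract_neq0 x : x != 0 -> retract x != 0.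
Proof. by move=> x0; rewrite /retract; case: ifP => // _; rewrite mulf_neq0. Qed.

Lemma subgroupN x : K (- x) <-> K x.
Proof.
have [_ _ KM] := sK; split=> Kx; last by rewrite -mulN1r; exact: KM.
by rewrite -[x]opprK -mulN1r; exact: KM.
Qed.

Lemma retract_additive : witt_additive (fun x => line (retract x)).
Proof.
apply: rigid_additive => [|a b b0|a|a t u t0 u0 E] /=.
- by rewrite /retract mulr0 if_same line0.
- rewrite /retract; case: asboolP => Ka; case: asboolP => Kab.
  + exact: line_square.
  + by case: Kab; apply/(subgroup_square _ sK b0).
  + by case: Ka; apply/(subgroup_square _ sK b0).
  + by rewrite mulrA line_square.
- rewrite /retract (asbool_equiv_eq (subgroupN a)); case: asboolP => _.
    by rewrite lineN subrr.
  by rewrite mulrN lineN subrr.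
- exact: line_four E.
Qed.

(** The ring endomorphism of the Witt ring induced by the projection of the square classes onto K
    with kernel generated by e. *)
Definition specialize : {additive W -> W} := projT1 (cid (witt_lift two_neq0 retract_additive)).

Lemma specialize_line x : specialize (line x) = line (retract x).
Proof. by rewrite /specialize; case: cid. Qed.

Lemma residue_additive :
  witt_additive (fun x => if `[< K x >] then 0 else line (e * x)).
Proof.
apply: rigid_additive => [|a b b0|a|a t u t0 u0 E] /=.
- by rewrite mulr0 line0 if_same.
- case: asboolP => Ka; case: asboolP => Kab //.
  + by case: Kab; apply/(subgroup_square a sK b0).
  + by case: Ka; apply/(subgroup_square a sK b0).
  + by rewrite mulrA line_square.
- rewrite (asbool_equiv_eq (subgroupN a)); case: asboolP => _; first by rewrite addr0.
  by rewrite mulrN lineN subrr.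
- by case: ifP => _; [rewrite mul0rn | exact: line_four E].
Qed.

(** With respect to the splitting of the Witt group into the classes with entries in K and those
    with entries in eK, this is the second component, divided by e. *)
Definition residue : {additive W -> W} := projT1 (cid (witt_lift two_neq0 residue_additive)).

Lemma residue_in x : K x -> residue (line x) = 0.
Proof. by move=> Kx; rewrite /residue; case: cid => f /= ->; case: asboolP. Qed.

Lemma residue_out x : ~ K x -> residue (line x) = line (e * x).
Proof. by move=> Kx; rewrite /residue; case: cid => f /= ->; case: asboolP. Qed.

(** Both sides are additive in x. On k in K this reads k = k - 0, and on ek it reads
    ek = k - (k - ek). *)
Lemma residue_decomposition x : x = specialize x - (residue x - scale e (residue x)).
Proof.
elim/witt_ind: x => [|x y IHx IHy|l]; first by rewrite !(raddf0, subr0).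
  rewrite {1}IHx {1}IHy (raddfD specialize x y) (raddfD residue x y) (raddfD (scale e)).
  by rewrite [LHS]addrACA -opprD; congr (_ - _); rewrite [LHS]addrACA -opprD.
rewrite specialize_line; have [Kl|Kl] := pselect (K l).
  by rewrite residue_in // retract_in // raddf0 !subr0.
rewrite residue_out // retract_out // opprB addrC subrK scale_line.
by rewrite mulrA -expr2 mulrC line_square.
Qed.

Lemma subgroup_mul x y : K x -> (K (x * y) <-> K y).
Proof.
move=> Kx; split; first exact: (subgroup_cancel sK Kx).
by case: sK => _ _; apply.
Qed.

Lemma subgroup_index x y : x != 0 -> y != 0 -> ~ K x -> ~ K y -> K (x * y).
Proof.
move=> x0 y0 Kx Ky; have [_ _ KM] := sK.
apply/(subgroup_square _ sK e0).
have -> : x * y * e ^+ 2 = (e * x) * (e * y) by ring.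
by apply: KM; apply: Kindex.
Qed.

Lemma specialize_scale b x : b != 0 ->
  specialize (scale b x) = scale (retract b) (specialize x).
Proof.
move=> b0; elim/witt_ind: x => [|x y IHx IHy|l]; first by rewrite !raddf0.
  by rewrite !raddfD /= IHx IHy.
rewrite scale_line !specialize_line scale_line.
have [->|l0] := eqVneq l 0; first by rewrite /retract !mulr0 !if_same ?mulr0.
have [Kb|Kb] := pselect (K b); have [Kl|Kl] := pselect (K l).
- by rewrite !retract_in //; apply/subgroup_mul.
- have Kbl : ~ K (b * l) by move=> /(subgroup_mul _ Kb).
  by rewrite (retract_in Kb) (retract_out Kl) (retract_out Kbl); congr (line _); ring.
- have Kbl : ~ K (b * l) by rewrite mulrC => /(subgroup_mul _ Kl).
  by rewrite (retract_in Kl) (retract_out Kb) (retract_out Kbl); congr (line _); ring.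
- rewrite (retract_out Kb) (retract_out Kl) retract_in; last exact: subgroup_index.
  have -> : e * b * (e * l) = b * l * e ^+ 2 by ring.
  by rewrite line_square.
Qed.

Lemma residue_scale_in b x : K b -> residue (scale b x) = scale b (residue x).
Proof.
move=> Kb; elim/witt_ind: x => [|x y IHx IHy|l]; first by rewrite !raddf0.
  by rewrite !raddfD /= IHx IHy.
rewrite scale_line; have [Kl|Kl] := pselect (K l).
  by rewrite !residue_in ?raddf0 //; apply/subgroup_mul.
have Kbl : ~ K (b * l) by move=> /(subgroup_mul _ Kb).
by rewrite (residue_out Kl) (residue_out Kbl) scale_line; congr (line _); ring.
Qed.

(** Multiplication by an element of eK exchanges the two components of x; the component in K is
    rho(x) - del(x). *)
Lemma residue_scale_out b x : b != 0 -> ~ K b ->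
  residue (scale b x) = scale (e * b) (specialize x - residue x).
Proof.
move=> b0 Kb; elim/witt_ind: x => [|x y IHx IHy|l]; first by rewrite !(raddf0, addr0).
  rewrite (raddfD (scale b)) (raddfD residue) IHx IHy -(raddfD (scale (e * b))).
  by rewrite (raddfD specialize) (raddfD residue) opprD addrACA.
rewrite scale_line specialize_line; have [->|l0] := eqVneq l 0.
  by rewrite /retract !mulr0 if_same line0 !(raddf0, addr0).
have [Kl|Kl] := pselect (K l).
  rewrite (residue_in Kl) subr0 residue_out; last by rewrite mulrC => /(subgroup_mul _ Kl).
  by rewrite retract_in // scale_line mulrA.
rewrite (residue_out Kl) retract_out // subrr raddf0 residue_in //.
exact: subgroup_index.
Qed.

Lemma specialize_fundamental n x : Ipow n x -> Ipow n (specialize x).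
Proof.
elim=> {n x} [x|n|n a x y a0 _ IHx _ IHy]; rewrite ?raddf0; [constructor|constructor|].
rewrite raddfD raddfB /= specialize_scale //; constructor => //; exact: retract_neq0.
Qed.

(** On a generator <<a>> y with a in K the residue is <<a>> del(y). With a in eK, put k = ea: then it
    is del(y) - k (rho(y) - del(y)) = <<-k>> del(y) - k rho(y), and rho(y) lies in the power of I
    that contains y, one higher than del(y). *)
Lemma residue_fundamental n x : Ipow n x -> Ipow n.-1 (residue x).
Proof.
elim=> {n x} [x|n|n a x y a0 Ix IHx _ IHy]; rewrite ?raddf0 /=; [constructor|exact: fundamental_zero|].
rewrite raddfD raddfB /=; apply: fundamental_add IHy.
case: n Ix IHx => [|n] Ix IHx; first by constructor.
have [Ka|Ka] := pselect (K a).
  by rewrite residue_scale_in //; exact: fundamental_pfister1.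
have ea0 : e * a != 0 by rewrite mulf_neq0.
rewrite residue_scale_out // (raddfB (scale (e * a))) opprB addrA.
apply: fundamental_sub; last by apply: fundamental_scale => //; exact: specialize_fundamental.
rewrite -[X in _ + X]opprK -scaleN; apply: fundamental_pfister1 => //.
by rewrite oppr_eq0.
Qed.

End Retraction.
End RigidMaps.

(** * Signatures and the two extreme cases *)

Section RigidPfister.
Variable F : fieldType.
Hypothesis two_neq0 : (2%:R : F) != 0.
Hypothesis rigidF : rigid F.
Implicit Types (a b c t u : F) (s : seq F) (K : F -> Prop).
Local Notation W := (witt two_neq0).
Local Notation line := (line two_neq0).
Local Notation scale := (scale two_neq0).
Local Notation Ipow := (@fundamental_power F two_neq0).
Local Notation pfister_sum := (@pfister_sum F two_neq0).
Local Notation pfister_class := (@pfister_class F two_neq0).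

(** A multiplicative character with values in {1, -1} extends to the Witt group, and
    <<a>> is multiplied by 1 - chi(a), which is 0 or 2; hence I^n goes into 2^n A. It is applied
    with A = Z/2, Z/4 and Z. *)
Lemma signature (A : comNzRingType) (chi : F -> A) :
  chi 0 = 0 ->
  (forall a, a != 0 -> chi a = 1 \/ chi a = -1) ->
  {morph chi : a b / a * b} ->
  chi (-1) = -1 ->
  (forall t u, t != 0 -> u != 0 -> 1 + t ^+ 2 = - u ^+ 2 -> 4%:R = 0 :> A) ->
  exists g : {additive W -> A},
    (forall a, g (line a) = chi a) /\
    (forall n x, Ipow n x -> exists y, g x = 2%:R ^+ n * y).
Proof.
move=> chi0 chi1 chiM chiN1 chi4.
have chi_add : witt_additive chi.
  apply: (rigid_additive rigidF) => // [a b b0|a|a t u t0 u0 E].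
  - by rewrite chiM expr2 chiM; case: (chi1 _ b0) => ->; rewrite ?mulrNN !mulr1.
  - by rewrite -mulN1r chiM chiN1 mulN1r subrr.
  - by rewrite -mulr_natr (chi4 _ _ t0 u0 E) mulr0.
have [g gE] := witt_lift two_neq0 chi_add; exists g; split=> //.
have gscale a x : g (scale a x) = chi a * g x.
  elim/witt_ind: x => [|x y IHx IHy|l]; first by rewrite !raddf0 mulr0.
    by rewrite !raddfD /= IHx IHy mulrDr.
  by rewrite scale_line !gE chiM.
move=> n x; elim=> {n x} [x|n|n a x y a0 _ [u IHx] _ [v IHy]].
- by exists (g x); rewrite mul1r.
- by exists 0; rewrite raddf0 mulr0.
rewrite raddfD raddfB /= gscale IHx IHy exprS.
case: (chi1 a a0) => ->; first by exists v; rewrite mul1r subrr add0r.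
by exists (u + v); ring.
Qed.

(** The character with kernel K, if K has index 2. *)
Definition sign_character (A : nzRingType) K (x : F) : A :=
  if x == 0 then 0 else if `[< K x >] then 1 else -1.

Lemma sign_characterM (A : nzRingType) K c : square_subgroup K -> c != 0 ->
  (forall x, x != 0 -> ~ K x -> K (c * x)) ->
  {morph sign_character A K : a b / a * b}.
Proof.
move=> sK c0 Kc a b; rewrite /sign_character mulf_eq0.
have [a0|a0] := eqVneq a 0; first by rewrite mul0r.
have [b0|b0] := eqVneq b 0; first by rewrite mulr0.
rewrite /=; case: (asboolP (K a)) => Ka; case: (asboolP (K b)) => Kb; case: asboolP => Kab //;
  rewrite ?mulrNN ?mulr1 ?mul1r //; exfalso.
- by apply: Kab; apply/subgroup_mul.
- by apply: Kb; move: Kab => /(subgroup_mul sK _ Ka).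
- by apply: Ka; move: Kab; rewrite mulrC => /(subgroup_mul sK _ Kb).
- by apply: Kab; exact: (subgroup_index sK c0 Kc).
Qed.

Lemma sign_signature (A : comNzRingType) K c : square_subgroup K -> c != 0 ->
  (forall x, x != 0 -> ~ K x -> K (c * x)) -> ~ K (-1) ->
  (forall t u, t != 0 -> u != 0 -> 1 + t ^+ 2 = - u ^+ 2 -> 4%:R = 0 :> A) ->
  exists g : {additive W -> A},
    (forall a, g (line a) = sign_character A K a) /\
    (forall n x, Ipow n x -> exists y, g x = 2%:R ^+ n * y).
Proof.
move=> sK c0 Kc KN1; apply: signature.
- by rewrite /sign_character eqxx.
- by move=> a a0; rewrite /sign_character (negPf a0); case: ifP; [left|right].
- exact: sign_characterM sK c0 Kc.
- by rewrite /sign_character oppr_eq0 oner_eq0; case: asboolP.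
Qed.

(** The trivial character modulo 2 counts the entries. *)
Lemma fundamental_parity s : 0 \notin s -> Ipow 1 (\sum_(a <- s) line a) -> ~~ odd (size s).
Proof.
move=> s0; have [|||||g [gE gI]] := @signature 'F_2 (fun a => (a != 0)%:R).
- by rewrite eqxx.
- by move=> a ->; left.
- by move=> a b; rewrite mulf_eq0 negb_or -natrM mulnb.
- by rewrite oppr_eq0 oner_neq0; apply/val_inj.
- by move=> *; apply/val_inj.
move=> /gI[y]; rewrite expr1 raddf_sum.
have -> : 2%:R = 0 :> 'F_2 by apply/val_inj.
rewrite mul0r (eq_big_seq (fun=> 1)) => [|a sa /=]; last first.
  by rewrite gE (_ : a != 0) //; apply: contraNneq s0 => <-.
rewrite big_const_seq count_predT iter_addr addr0 => /(congr1 val) /=.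
by rewrite val_Fp_nat // modn2; case: odd.
Qed.

Definition squares : F -> Prop := fun x => exists2 t, t != 0 & x = t ^+ 2.

Lemma squares_subgroup : square_subgroup squares.
Proof.
split=> [x [t t0 ->]|t t0|x y [t t0 ->] [u u0 ->]]; first by rewrite expf_neq0.
  by exists t.
by exists (t * u); rewrite ?mulf_neq0 // exprMn.
Qed.

(** A class <a,b> in I^2 has trivial discriminant -ab. If -ab were not a square, take K of index 2
    missing -ab. If -1 is in K, exactly one of a, b lies outside K, so the residue, which lies in I,
    would be a single line. If -1 is not in K, then a and b have the same sign with respect
    to K, and the signature modulo 4 of <a,b> would be 2 instead of 0. *)
Lemma fundamental2_small s : (size s <= 2)%N -> 0 \notin s ->
  Ipow 2 (\sum_(a <- s) line a) -> \sum_(a <- s) line a = 0.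
Proof.
move=> s2 s0 I2; have := fundamental_parity s0 (fundamental_weaken I2).
case: s s2 s0 I2 => [|a [|b [|c s]]] //= _; first by rewrite big_nil.
rewrite !inE !negb_or ![0 == _]eq_sym !big_cons big_nil addr0 => /andP[a0 b0] I2 _.
have [[t t0 E]|nsq] := pselect (squares (- (a * b))).
  have -> : b = - a * (t / a) ^+ 2.
    by apply: (mulfI a0); rewrite -[LHS]opprK E; field.
  by rewrite line_square ?mulf_neq0 ?invr_eq0 // lineN subrr.
have c0 : - (a * b) != 0 by rewrite oppr_eq0 mulf_neq0.
have [K [sK _ Kc Ki]] := subgroup_avoiding squares_subgroup c0 nsq.
have [KN1|KN1] := pselect (K (-1)).
  have Kab : ~ K (a * b) by move=> Kab; apply: Kc; apply/(subgroupN sK KN1).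
  have := residue_fundamental rigidF sK KN1 c0 Ki I2.
  rewrite raddfD /=; set r := residue _ _ _ _ _ => /=.
  have one l : l != 0 -> ~ Ipow 1 (line l).
    move=> l0 I1; have := @fundamental_parity [:: l].
    by rewrite big_seq1 inE eq_sym => /(_ l0 I1).
  have [Ka|Ka] := pselect (K a); have [Kb|Kb] := pselect (K b).
  - by case: Kab; apply/(subgroup_mul sK _ Ka).
  - rewrite residue_in // residue_out // add0r => /one h; exfalso; apply: h.
    by rewrite mulf_neq0.
  - rewrite residue_out // residue_in // addr0 => /one h; exfalso; apply: h.
    by rewrite mulf_neq0.
  - by case: Kab; exact: (subgroup_index sK c0 Ki).
have [|g [gE gI]] := @sign_signature 'Z_4 K _ sK c0 Ki KN1; first by move=> *; apply/val_inj.
have [y] := gI _ _ I2; rewrite raddfD /= !gE.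
have -> : 2%:R ^+ 2 = 0 :> 'Z_4 by apply/val_inj.
have Kab : K (a * b).
  apply: contrapT => Kab; apply: Kc; rewrite -mulN1r.
  by apply: (subgroup_index sK c0 Ki) => //; rewrite ?oppr_eq0 ?oner_neq0 ?mulf_neq0.
rewrite mul0r /sign_character (negPf a0) (negPf b0).
have KE : K a <-> K b.
  split=> [Ka|Kb]; first exact/(subgroup_mul sK b Ka).
  by apply/(subgroup_mul sK a Kb); rewrite mulrC.
by rewrite (asbool_equiv_eq KE); case: asboolP => _ /(congr1 val).
Qed.

(** Splitting off a<<-ab,-ac>> = <a,b,c,abc> replaces three entries by the single entry -abc. *)
Lemma pfister_sum_fundamental2 s : 0 \notin s -> Ipow 2 (\sum_(a <- s) line a) ->
  exists2 k, (k <= size s)%N & pfister_sum 2 k (\sum_(a <- s) line a).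
Proof.
have [m] := ubnP (size s); elim: m s => // m IHm s sm s0 I2.
have [s2|] := leqP (size s) 2.
  by exists 0%N => //; rewrite fundamental2_small //; constructor.
case: s sm s0 I2 => [|a [|b [|c s]]] //= sm + I2 _.
rewrite !inE !negb_or ![0 == _]eq_sym => /and4P[a0 b0 c0 s0].
pose q := scale a (pfister_class [:: - (a * b); - (a * c)]).
have E : \sum_(x <- [:: a, b, c & s]) line x = q + \sum_(x <- - (a * b * c) :: s) line x.
  rewrite /q /= scaleN scaleN !opprK raddfD /= raddfD /= !raddfD /=.
  rewrite !scale_line !mulr1 !big_cons lineN.
  have -> : line (a * (a * c)) = line c by rewrite -(line_square _ c a0); congr (line _); ring.
  have -> : line (a * (a * b)) = line b by rewrite -(line_square _ b a0); congr (line _); ring.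
  have -> : line (a * (a * b * (a * c))) = line (a * b * c).
    by rewrite -(line_square _ (a * b * c) a0); congr (line _); ring.
  by rewrite [RHS]addrA [X in _ = X - _ + _]addrA addrK [X in _ = X + _]addrAC -!addrA.
have Iq : Ipow 2 q.
  apply: fundamental_scale => //=.
  apply: fundamental_pfister1; first by rewrite oppr_eq0 mulf_neq0.
  apply: fundamental_pfister1; first by rewrite oppr_eq0 mulf_neq0.
  by constructor.
have abc0 : - (a * b * c) != 0 by rewrite oppr_eq0 !mulf_neq0.
have [||| k ks hk] := IHm (- (a * b * c) :: s).
- by rewrite /= -ltnS; exact: leq_trans sm.
- by rewrite inE negb_or eq_sym abc0.
- by rewrite -[X in Ipow _ X](addKr q) -E addrC; exact: fundamental_sub.
exists k.+1; first by rewrite /= in ks; apply: leq_trans ks _.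
rewrite E; apply: PfisterSumS => //.
by rewrite !inE !negb_or ![0 == _]eq_sym !oppr_eq0 !mulf_neq0.
Qed.

Lemma unit_span_multiple s : (forall a, a \in s -> squares a \/ squares (- a)) ->
  exists2 j : int, (absz j <= size s)%N & \sum_(a <- s) line a = line 1 *~ j.
Proof.
elim: s => [|a s IHs] hs; first by exists 0; rewrite ?big_nil ?mulr0z.
have [b bs|j js E] := IHs; first by apply: hs; rewrite inE bs orbT.
have [i i1 Ea] : exists2 i : int, (absz i <= 1)%N & line a = line 1 *~ i.
  have l1 t : t != 0 -> line (t ^+ 2) = line 1 by move=> t0; rewrite -[t ^+ 2]mul1r line_square.
  have [[t t0 Et]|[t t0 Et]] := hs a (mem_head _ _).
    by exists 1; rewrite // Et l1.
  by exists (-1); rewrite // -[a]opprK Et lineN l1 // mulrNz.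
exists (i + j); last by rewrite big_cons Ea E mulrzDr.
by rewrite /=; lia.
Qed.

Lemma pfister_class_minus_one n : pfister_class (nseq n (-1)) = line 1 *+ 2 ^ n.
Proof.
elim: n => [|n IHn] //=; rewrite IHn scaleN scale1 opprK -mulrnDr.
by rewrite addnn expnS mul2n.
Qed.

Lemma pfister_sum_minus_one n (j : int) :
  pfister_sum n (absz j) ((line 1 *+ 2 ^ n) *~ j).
Proof.
have pos m : pfister_sum n m ((line 1 *+ 2 ^ n) *+ m).
  elim: m => [|m IHm]; first exact: PfisterSum0.
  rewrite mulrS -pfister_class_minus_one -[pfister_class _]scale1.
  apply: PfisterSumS; rewrite ?oner_neq0 ?size_nseq //; last by rewrite scale1 pfister_class_minus_one.
  by rewrite mem_nseq negb_and eq_sym oppr_eq0 oner_neq0 orbT.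
case: j => m; first by rewrite -pmulrn; exact: pos.
by rewrite NegzE mulrNz abszN /=; apply: pfister_sum_opp; rewrite -pmulrn; exact: pos.
Qed.

(** If 4<1> = 0, then j<1> is one of 0, <1>, <1,1>, <-1>, and fundamental2_small applies. Otherwise
    -1 is not a square, and no 1 + t^2 is minus a nonzero square, so the sign character of a
    subgroup that misses -1 extends to an integral signature with value j. *)
Lemma pfister_sum_unit_span n s :
  (forall a, a \in s -> squares a \/ squares (- a)) ->
  Ipow n.+2 (\sum_(a <- s) line a) ->
  exists2 k, (k <= size s)%N & pfister_sum n.+2 k (\sum_(a <- s) line a).
Proof.
move=> /unit_span_multiple[j js E]; rewrite E => In.
have [l4|l4] := eqVneq (line 1 *+ 4) 0.
  have I2 : Ipow 2 (line 1 *~ j).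
    by elim: n In => // n IHn /fundamental_weaken.
  exists 0%N => //; suff -> : line 1 *~ j = 0 by exact: PfisterSum0.
  have [r r4 jr] : exists2 r : nat, (r < 4)%N & line 1 *~ j = line 1 *+ r.
    exists (absz (j %% 4)%Z); first by lia.
    have Ej : j = Posz 4 * (j %/ 4)%Z + Posz (absz (j %% 4)%Z) by lia.
    by rewrite [in LHS]Ej mulrzDr mulrzA -!pmulrn l4 mul0rz add0r.
  have small s' : (size s' <= 2)%N -> 0 \notin s' ->
      line 1 *~ j = \sum_(a <- s') line a -> line 1 *~ j = 0.
    by move=> s2 s0 Es; move: I2; rewrite Es; exact: fundamental2_small.
  have n1 : (0 : F) != 1 by rewrite eq_sym oner_neq0.
  case: r r4 jr => [|[|[|[|]]]] // _ jr.
  - by apply: (small [:: 1]); rewrite ?inE // big_seq1.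
  - by apply: (small [:: 1; 1]); rewrite ?inE ?negb_or ?n1 // !big_cons big_nil addr0.
  - apply: (small [:: -1]); rewrite ?inE // ?big_seq1 ?lineN; first by rewrite eq_sym oppr_eq0 oner_neq0.
    by rewrite jr; apply/eqP; rewrite -subr_eq0 opprK -mulrSr l4.
have nsq : ~ squares (-1).
  move=> [t t0 Et]; move/eqP: l4; apply.
  have E2 : line 1 + line 1 = 0.
    by rewrite -{1}(line_square _ _ t0) mul1r -Et lineN addNr.
  by rewrite !mulrS mulr0n addr0 addrA E2 add0r.
have n10 : (-1 : F) != 0 by rewrite oppr_eq0 oner_neq0.
have [K [sK _ KN1 Ki]] := subgroup_avoiding squares_subgroup n10 nsq.
have [|g [gE gI]] := @sign_signature int K _ sK n10 Ki KN1.
  by move=> t u t0 u0 h; case/eqP: l4; exact: line_four h.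
have [q] := gI _ _ In; rewrite raddfMz gE.
have -> : sign_character int K 1 = 1.
  have [_ Ksq _] := sK; rewrite /sign_character oner_eq0; case: asboolP => // [[]].
  by rewrite -[1](expr1n _ 2); apply: Ksq; exact: oner_neq0.
rewrite intz => jq; exists (absz q).
  apply: leq_trans js; rewrite jq abszM leq_pmull // abszX.
  by rewrite expn_gt0.
rewrite jq mulrzA -[_ ^+ _]natrX natz -pmulrn.
exact: pfister_sum_minus_one.
Qed.

End RigidPfister.

(** * Induction on the square classes of the entries *)

Section Bound.
Variable F : fieldType.
Hypothesis two_neq0 : (2%:R : F) != 0.
Hypothesis rigidF : rigid F.
Implicit Types (a b c t u : F) (s g : seq F).
Local Notation line := (line two_neq0).
Local Notation scale := (scale two_neq0).
Local Notation Ipow := (@fundamental_power F two_neq0).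
Local Notation pfister_sum := (@pfister_sum F two_neq0).

(** The subgroup generated by -1, the nonzero squares and the nonzero members of g. *)
Fixpoint square_span g : F -> Prop := fun x =>
  if g is a :: g' then square_span g' x \/ (a != 0 /\ square_span g' (a * x))
  else squares x \/ squares (- x).

Lemma square_span_subgroup g : square_subgroup (square_span g).
Proof.
elim: g => [|a g [IH0 IHsq IHM]] /=.
  have [S0 Ssq SM] := squares_subgroup F; split=> [x|t t0|x y].
  - by case=> /S0; rewrite ?oppr_eq0.
  - by left; exact: Ssq.
  - case=> Sx [] Sy; [left|right|right|left].
    + exact: SM.
    + by rewrite -mulrN; exact: SM.
    + by rewrite -mulNr; exact: SM.
    + by rewrite -mulrNN; exact: SM.
split=> [x|t t0|x y].
- by case=> [/IH0|[_ /IH0]] //; rewrite mulf_eq0 negb_or => /andP[].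
- by left; exact: IHsq.
- case=> [Sx|[a0 Sx]] [Sy|[b0 Sy]].
  + by left; exact: IHM.
  + by right; split=> //; rewrite mulrCA; exact: IHM.
  + by right; split=> //; rewrite mulrA; exact: IHM.
  + left; apply/(subgroup_square (x * y) _ a0); first by split.
    have -> : x * y * a ^+ 2 = (a * x) * (a * y) by ring.
    exact: IHM.
Qed.

Lemma square_spanN1 g : square_span g (-1).
Proof.
elim: g => [|a g IH] /=; last by left.
by right; exists 1; rewrite ?oner_neq0 // opprK expr1n.
Qed.

Lemma square_span_mem g x : x != 0 -> x \in g -> square_span g x.
Proof.
move=> x0; elim: g => [//|a g IH]; rewrite inE => /orP[/eqP <-|/IH]; last by left.
right; split=> //; have [_ Ssq _] := square_span_subgroup g.
by rewrite -expr2; exact: Ssq.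
Qed.

(** Induction on g through the recursion B(n, m+1) <= B(n, m) + B(n-1, m). The exponent n counts
    the folds above 2, so n = 0 is the case of I^2. *)
Lemma pfister_sum_rigid d g n s : (size s <= d)%N ->
  (forall x, x \in s -> square_span g x) -> Ipow n.+2 (\sum_(a <- s) line a) ->
  exists2 k, (k <= d * (size g).+1 ^ n)%N & pfister_sum n.+2 k (\sum_(a <- s) line a).
Proof.
elim: g n s => [|e g IHg] n s sd sg In.
  have [k ks hk] := pfister_sum_unit_span rigidF sg In.
  by exists k => //; rewrite exp1n muln1; exact: leq_trans ks sd.
have sKg := square_span_subgroup g; have [Kg0 _ _] := sKg.
have s0 : 0 \notin s.
  by apply/negP=> /sg; have [/(_ 0) h _ _] := square_span_subgroup (e :: g) => /h; rewrite eqxx.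
case: n In => [|n] In.
  have [k ks hk] := pfister_sum_fundamental2 rigidF s0 In; exists k => //.
  by rewrite expn0 muln1; exact: leq_trans ks sd.
(* If e is already in the span of g, then it can be dropped. *)
have [[e0 ge]|deg] := pselect (e != 0 /\ ~ square_span g e); last first.
  have sg' x : x \in s -> square_span g x.
    move=> /sg[//|[e0 gex]]; apply: (subgroup_cancel sKg _ gex).
    by apply: contrapT => ge; apply: deg.
  have [k kd hk] := IHg n.+1 s sd sg' In; exists k => //.
  by apply: leq_trans kd _; rewrite leq_mul2l leq_exp2r // leqnSn orbT.
have [K [sK gK Ke Ki]] := subgroup_avoiding sKg e0 ge.
have KN1 := gK _ (square_spanN1 g).
(* Specialisation and residue of the diagonal class are again diagonal, with entries in the span of
   g and at most as many of them. *)
pose x := \sum_(a <- s) line a.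
pose rho := specialize two_neq0 rigidF e sK KN1; pose del := residue two_neq0 rigidF e sK KN1.
have split_s a : a \in s -> (K a /\ square_span g a) \/ (~ K a /\ square_span g (e * a)).
  move=> /sg[ga|[_ gea]]; first by left; split=> //; exact: gK.
  right; split=> // Ka; apply: Ke; apply: (subgroup_cancel sK Ka).
  by rewrite mulrC; exact: gK.
have rhoE : rho x = \sum_(a <- map (retract K e) s) line a.
  by rewrite raddf_sum big_map; apply: eq_bigr => a _; exact: specialize_line.
have delE : del x = \sum_(a <- [seq e * a | a <- s & ~~ `[< K a >]]) line a.
  rewrite raddf_sum big_map big_filter [LHS](bigID (fun a => `[< K a >])) /=.
  rewrite big1 ?add0r => [|a /asboolP Ka]; last exact: residue_in.
  by apply: eq_bigr => a /asboolPn Ka; exact: residue_out.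
have [|a||k kd hk] := IHg n.+1 (map (retract K e) s).
- by rewrite size_map.
- move=> /mapP[b /split_s[[Kb gb]|[Kb gb]] ->]; first by rewrite retract_in.
  by rewrite retract_out.
- by rewrite -rhoE; exact: specialize_fundamental.
have [|a||l ld hl] := IHg n [seq e * a | a <- s & ~~ `[< K a >]].
- by rewrite size_map size_filter; exact: leq_trans (count_size _ _) sd.
- move=> /mapP[b]; rewrite mem_filter => /andP[/asboolPn Kb /split_s[[//]|[_ gb]] ->].
  exact: gb.
- by rewrite -delE; have := residue_fundamental rigidF sK KN1 e0 Ki In.
exists (k + l)%N.
  apply: leq_trans (leq_add kd ld) _; rewrite -mulnDr leq_mul2l; apply/orP; right.
  rewrite [X in (X + _ <= _)%N]expnS -[X in (_ + X <= _)%N]mul1n -mulnDl addn1.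
  rewrite [X in (_ <= X)%N]expnS leq_mul2l /=; by case: (n) => // m; rewrite leq_exp2r.
rewrite -/x (residue_decomposition rigidF sK KN1 e0 x).
apply: pfister_sum_add; first by rewrite -/rho rhoE.
apply: pfister_sum_opp; apply: pfister_sum_pfister1 => //.
by rewrite -/del delE.
Qed.

Lemma rigid_sum_of_GP n d (phi : qform F) : (qdim phi <= d)%N -> in_In n.+2 phi ->
  exists2 k, (k <= d.+1 ^ n.+1)%N & sum_of_GP n.+2 k phi.
Proof.
move=> phid /(in_In_fundamental two_neq0).
have [s [ss s0 hs]] := diagonalize two_neq0 phi.
have classE := congruent_class two_neq0 hs.
rewrite classE class_qdiag => In.
have sd : (size s <= d)%N by rewrite ss.
have sg x : x \in s -> square_span s x.
  by move=> xs; apply: (square_span_mem _ xs); apply: contraNneq s0 => <-.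
have [k kd] := pfister_sum_rigid sd sg In.
rewrite -class_qdiag -classE => /sum_of_GP_pfister_sum hk.
exists k => //; apply: leq_trans kd _; rewrite expnS.
apply: leq_mul; first exact: leqnSn.
by case: n {In hk} => [|n]; rewrite ?expn0 // leq_exp2r // ltnS.
Qed.

End Bound.

Theorem theorem7p6 (R : realType) (n : nat) (hn : (3 <= n)%N) :
  exists p : {poly rat},
    [/\ size p = n (* degree n - 1 *),
        forall x y : R, 0 <= x -> x < y ->
          (map_poly ratr p).[x] < (map_poly ratr p).[y],
        forall x : R, 0 <= x -> 0 <= (map_poly ratr p).[x]
      & forall F : fieldType, (2%:R : F) != 0 -> rigid F ->
        forall d : nat, ~~ odd d -> (2 ^ n <= d)%N ->
          (pfister_bound F R n d <= ((map_poly ratr p).[d%:R])%:E)%E].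
Proof.
case: n hn => [|[|n]] // hn.
pose p : {poly rat} := ('X + 1) ^+ n.+1.
have pE (x : R) : (map_poly ratr p).[x] = (x + 1) ^+ n.+1.
  by rewrite rmorphXn rmorphD /= map_polyX rmorph1 horner_exp !hornerE.
exists p; split.
- by rewrite /p -(size_exp_XsubC n.+1 (-1 : rat)) polyCN opprK.
- move=> x y x0 xy; rewrite !pE ltrXn2r ?ltrD2r ?ler_wpDr //.
- by move=> x x0; rewrite pE exprn_ge0 // addr_ge0.
move=> F two_neq0 rigidF d _ _; apply: ge_ereal_sup => _ [phi [Iphi phid] <-].
have [k kd hk] := rigid_sum_of_GP two_neq0 rigidF phid Iphi.
apply: (@le_trans _ _ (k%:R%:E)); first by apply: ereal_inf_lbound; exists k.
rewrite lee_fin pE natr1 -natrX ler_nat.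
by [].
Qed.
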